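(* (In ZFC.) If $\kappa$ is a subtle cardinal, then for some regular $\lambda$ with $V_\lambda$ an elementary substructure of $V_\kappa$, there is $R\subset\lambda$ such that $(V_\lambda,\in,R)$ satisfies axioms A1–A8 (listed in the context).
   Context: A cardinal $\kappa$ is subtle if for every closed unbounded $C\subset\kappa$ and every sequence $\langle A_\delta:\delta\in C\rangle$ with $A_\delta\subset\delta$ there are $\alpha<\beta$ in $C$ with $A_\alpha=A_\beta\cap\alpha$. The axioms are in the language of set theory with an additional unary predicate $R$; ''reflective cardinal'' means an element of $R$. ''$R$-formula'' means formula in which $R$ may occur. A1. $\forall x \exists y \forall z\,(z \in y \Leftrightarrow z \in x \wedge R(z))$. A2. $\forall a\,(R(a) \Rightarrow a \text{ is an ordinal})$. A3. For all $a,b,c$: if $a$ is an ordinal, $R(b)$, $R(c)$ and $0<a<b<c$, then $R(a)$ holds if and only if for all (codes of) formulas $\varphi$ of set theory (without $R$) with two free variables and all $s\in V_a$, $(V_b\models\varphi(a,s)) \Leftrightarrow (V_c\models \varphi(b,s))$. A4. There is a proper class of reflective cardinals. A5. The axiom schema of replacement for $R$-formulas. A6. (Schema, for every $R$-formula $\psi$, $\kappa$ not free in $\psi$) $\exists\kappa\in R\ \forall s\in V_\kappa\,(\psi(s)\Leftrightarrow V_\kappa\models\psi(s))$, where $V_\kappa\models\psi(s)$ is evaluated in $(V_\kappa,\in,R\cap V_\kappa)$. A7. Reflective cardinals are regular. A8. Reflective cardinals are fully indescribable: for all $\kappa\in R$, all $b\in R$ with $b>\kappa$, all (codes of) formulas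 $\varphi$ of set theory (without $R$) with two free variables, and all $A\subset\kappa$: $V_b\models(\varphi(\kappa,A)\Rightarrow\exists\lambda<\kappa\ \varphi(\lambda,A\cap\lambda))$. *)

(* Defs.v *)
(* Plain Rocq, no library: set theory is stated over an arbitrary membership
   structure, so that the same definitions can be read in the universe of sets
   and, relativized, in a structure (V_l, ∈, R). *)

Set Implicit Arguments.
Unset Strict Implicit.
Unset Printing Implicit Defensive.

Record setStruct : Type := SetStruct {
  carrier :> Type;
  mem : carrier -> carrier -> Prop
}.

Notation "x ∈ y" := (mem x y) (at level 70, no associativity).

Definition subset (M : setStruct) (x y : M) : Prop :=
  forall z : M, z ∈ x -> z ∈ y.

Notation "x ⊆ y" := (subset x y) (at level 70, no associativity).

Section Basic.
Variable M : setStruct.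
Implicit Types x y z a b f p u v : M.

Definition is_pair p x y : Prop := forall z, z ∈ p <-> z = x \/ z = y.

Definition is_opair p x y : Prop :=
  exists u v, is_pair u x x /\ is_pair v x y /\ is_pair p u v.

Definition is_succ y x : Prop := forall z, z ∈ y <-> z ∈ x \/ z = x.

Definition is_inter y x a : Prop := forall z, z ∈ y <-> z ∈ x /\ z ∈ a.

Definition maps f x y : Prop := exists p, is_opair p x y /\ p ∈ f.

Definition is_fun f a : Prop :=
  (forall p, p ∈ f -> exists x y, is_opair p x y /\ x ∈ a) /\
  (forall x, x ∈ a -> exists! y, maps f x y).

Definition is_fun_into f a b : Prop :=
  is_fun f a /\ forall x y, maps f x y -> y ∈ b.

End Basic.

(* The separation and replacement schemas range over all predicates of the
   ambient logic, in particular over those given by formulas with parameters. *)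
Record ZFC (M : setStruct) : Prop := {
  zf_extensionality : forall x y : M, (forall z, z ∈ x <-> z ∈ y) -> x = y;
  zf_foundation : forall x : M, (exists y, y ∈ x) ->
    exists y, y ∈ x /\ ~ exists z, z ∈ x /\ z ∈ y;
  zf_pairing : forall x y : M, exists p, is_pair p x y;
  zf_union : forall x : M, exists u,
    forall z, z ∈ u <-> exists y, y ∈ x /\ z ∈ y;
  zf_power : forall x : M, exists p, forall z, z ∈ p <-> z ⊆ x;
  zf_infinity : exists x : M,
    (exists z, z ∈ x /\ forall t, ~ t ∈ z) /\
    (forall y, y ∈ x -> exists z, is_succ z y /\ z ∈ x);
  zf_separation : forall (P : M -> Prop) (x : M), exists y,
    forall z, z ∈ y <-> z ∈ x /\ P z;
  zf_replacement : forall (F : M -> M -> Prop) (x : M),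
    (forall u v w, u ∈ x -> F u v -> F u w -> v = w) ->
    exists y, forall v, v ∈ y <-> exists u, u ∈ x /\ F u v;
  zf_choice : forall x : M,
    (forall y, y ∈ x -> exists z, z ∈ y) ->
    (forall y y' z, y ∈ x -> y' ∈ x -> z ∈ y -> z ∈ y' -> y = y') ->
    exists c, forall y, y ∈ x -> exists! z, z ∈ y /\ z ∈ c
}.

Section Ordinals.
Variable M : setStruct.
Implicit Types x y z a b c f v k C A : M.

Definition transitive_set a : Prop := forall x, x ∈ a -> x ⊆ a.

Definition well_ordered_by_mem a : Prop :=
  (forall x, x ∈ a -> ~ x ∈ x) /\
  (forall x y z, x ∈ a -> y ∈ a -> z ∈ a -> x ∈ y -> y ∈ z -> x ∈ z) /\
  (forall x y, x ∈ a -> y ∈ a -> x ∈ y \/ x = y \/ y ∈ x) /\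
  (forall b, b ⊆ a -> (exists x, x ∈ b) ->
     exists x, x ∈ b /\ forall y, y ∈ b -> x = y \/ x ∈ y).

Definition is_ordinal a : Prop := transitive_set a /\ well_ordered_by_mem a.

Definition is_limit a : Prop :=
  is_ordinal a /\ (exists x, x ∈ a) /\
  (forall x, x ∈ a -> exists y, y ∈ a /\ x ∈ y).

Definition is_bijection f a b : Prop :=
  is_fun_into f a b /\ forall y, y ∈ b -> exists! x, maps f x y.

Definition is_cardinal k : Prop :=
  is_ordinal k /\ forall a, a ∈ k -> ~ exists f, is_bijection f a k.

(* The infinite cardinals are the cardinals that are limit ordinals. *)
Definition is_regular k : Prop :=
  is_cardinal k /\ is_limit k /\
  (forall a f, a ∈ k -> is_fun_into f a k ->
     exists b, b ∈ k /\ forall x y, maps f x y -> y ∈ b).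

(* v = V_a: there is a function f on a + 1 with f(a) = v and, for all x <= a,
   f(x) the union of the power sets of the f(x'), x' < x. *)
Definition is_V a v : Prop :=
  exists f s, is_succ s a /\ is_fun f s /\
    (forall x y, maps f x y -> forall z, z ∈ y <->
       exists x' y', x' ∈ x /\ maps f x' y' /\ z ⊆ y') /\
    maps f a v.

Definition in_V a x : Prop := exists v, is_V a v /\ x ∈ v.

(* "Unbounded" is stated with <= rather than <, so that {n} is unbounded in
   n + 1; this keeps finite ordinals from being vacuously subtle and changes
   nothing for limit ordinals. *)
Definition is_club C k : Prop :=
  C ⊆ k /\
  (forall x, x ∈ k -> exists y, y ∈ C /\ (x = y \/ x ∈ y)) /\
  (forall x, x ∈ k -> (exists y, y ∈ x) ->
     (forall y, y ∈ x -> exists z, z ∈ C /\ z ∈ x /\ y ∈ z) -> x ∈ C).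

Definition is_subtle k : Prop :=
  is_cardinal k /\
  forall C A, is_club C k -> is_fun A C ->
    (forall d Ad, maps A d Ad -> Ad ⊆ d) ->
    exists a b Aa Ab, a ∈ C /\ b ∈ C /\ a ∈ b /\
      maps A a Aa /\ maps A b Ab /\ is_inter Aa Ab a.

End Ordinals.

(* Formulas of the language {∈, R}, with de Bruijn indices: in [fAll p] index 0
   of p is the bound variable. *)
Inductive formula : Type :=
| fMem (i j : nat)
| fEq (i j : nat)
| fR (i : nat)
| fBot
| fImp (p q : formula)
| fAll (p : formula).

Fixpoint R_free (p : formula) : Prop :=
  match p with
  | fR _ => False
  | fMem _ _ | fEq _ _ | fBot => True
  | fImp p q => R_free p /\ R_free q
  | fAll p => R_free p
  end.

Fixpoint fv_below (n : nat) (p : formula) : Prop :=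
  match p with
  | fMem i j | fEq i j => i < n /\ j < n
  | fR i => i < n
  | fBot => True
  | fImp p q => fv_below n p /\ fv_below n q
  | fAll p => fv_below (S n) p
  end.

Definition scons (T : Type) (x : T) (e : nat -> T) (i : nat) : T :=
  match i with 0 => x | S j => e j end.

(* Satisfaction in the structure with domain D, membership inherited from M,
   and unary predicate R. *)
Fixpoint sat (M : setStruct) (D R : M -> Prop) (p : formula) (e : nat -> M)
    : Prop :=
  match p with
  | fMem i j => e i ∈ e j
  | fEq i j => e i = e j
  | fR i => R (e i)
  | fBot => False
  | fImp p q => sat D R p e -> sat D R q e
  | fAll p => forall x, D x -> sat D R p (scons x e)
  end.

Definition no_pred (M : setStruct) (_ : M) : Prop := False.

(* (d, ∈) satisfies p; meant for formulas without R. *)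
Definition set_sat (M : setStruct) (d : M) (p : formula) (e : nat -> M) : Prop :=
  sat (fun x => x ∈ d) (@no_pred M) p e.

Definition elementary_substructure (M : setStruct) (d d' : M) : Prop :=
  d ⊆ d' /\
  forall p : formula, R_free p -> forall e : nat -> M, (forall i, e i ∈ d) ->
    (set_sat d p e <-> set_sat d' p e).

Section ReflectiveAxioms.
Variables (M : setStruct) (R : M -> Prop).
Implicit Types a b c k l x y z s A B : M.

(* R-free formulas whose free variables are among the first two. *)
Definition set_formula2 (p : formula) : Prop := R_free p /\ fv_below 2 p.

(* V_b satisfies p(x, s), for p a [set_formula2]. *)
Definition V_sat2 b (p : formula) x s : Prop :=
  exists v, is_V b v /\ set_sat v p (scons x (fun _ => s)).

(* (V_k, ∈, R ∩ V_k) satisfies p(s), for p with one free variable. *)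
Definition V_satR1 k (p : formula) s : Prop :=
  exists v, is_V k v /\
    sat (fun x => x ∈ v) (fun x => R x /\ x ∈ v) p (fun _ => s).

Record reflective_axioms : Prop := {
  ax_R_comprehension :
    forall x, exists y, forall z, z ∈ y <-> z ∈ x /\ R z;
  ax_R_ordinal :
    forall a, R a -> is_ordinal a;
  ax_R_indiscernible :
    forall a b c, is_ordinal a -> R b -> R c ->
      (exists x, x ∈ a) -> a ∈ b -> b ∈ c ->
      (R a <-> forall p, set_formula2 p -> forall s, in_V a s ->
                 (V_sat2 b p a s <-> V_sat2 c p b s));
  ax_R_proper_class :
    ~ exists x, forall a, a ∈ x <-> R a;
  ax_R_replacement :
    forall (p : formula) (e : nat -> M),
      let F u v := sat (fun _ => True) R p (scons u (scons v e)) in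
      forall x, (forall u v w, u ∈ x -> F u v -> F u w -> v = w) ->
        exists y, forall v, v ∈ y <-> exists u, u ∈ x /\ F u v;
  ax_R_reflection :
    forall p, fv_below 1 p ->
      exists k, R k /\ forall s, in_V k s ->
        (sat (fun _ => True) R p (fun _ => s) <-> V_satR1 k p s);
  ax_R_regular :
    forall k, R k -> is_regular k;
  ax_R_indescribable :
    forall k b, R k -> R b -> k ∈ b ->
      forall p, set_formula2 p -> forall A, A ⊆ k ->
        V_sat2 b p k A ->
        exists l B, l ∈ k /\ is_inter B A l /\ V_sat2 b p l B
}.

End ReflectiveAxioms.

Definition substructure (M : setStruct) (d : M) : setStruct :=
  @SetStruct {x : M | x ∈ d} (fun x y => proj1_sig x ∈ proj1_sig y).

Definition restrict_pred (M : setStruct) (d r : M) (x : substructure d) : Prop :=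
  proj1_sig x ∈ r.

(* Main.v *)
(* For an ordinal a below the subtle cardinal k let T(a) be the set of pairs
   (p, s) with s in V_a and V_k |= p(a, s).  Attach to each d < k the data T(d)
   and, whenever they exist, a witness that d is singular, a function G : d -> d
   such that T(a) <> T(d) restricted to V_a for every limit a < d closed under
   G, and a formula with parameter describing d.  If every d in a club had one
   of these defects, subtlety would give a < b with coherent data: a witness of
   singularity for a would be one for b but bounded below b, the closure point a
   of the function of b would have T(a) = T(b) restricted to V_a, and a would
   satisfy the formula describing b.  So some l with V_l elementary in V_k is
   regular, indescribable in V_k, and such that
     R = {a < l : a <> 0 and T(a) = T(l) restricted to V_a}
   meets every club of l.  Then A3 holds by the definition of R, A4 and A6 by
   stationarity, and A7 and A8 because regularity and indescribability are
   recorded in T(l), hence in T(a) for a in R. *)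

From Stdlib Require Import Classical ClassicalEpsilon FunctionalExtensionality.
From Stdlib Require Import Cantor Arith Lia.
Require Import Defs.

Set Implicit Arguments.
Unset Strict Implicit.
Unset Printing Implicit Defensive.

(** Subtlety speaks of subsets of ordinals, whereas the data attached to d are countably many
    subsets of V_d. To code them inside d, a rank-compatible well-order of the universe must give
    the elements of V_d positions below d on a club; for this k is first shown to be inaccessible,
    from subtlety alone. The sets of ordinals with a given defect belong to an ideal ([small]), so
    that all defects are avoided at once, while whatever holds on a club (elementarity, control of
    positions) is imposed as closure under a function. T is computed in V_k, but A3 and A8 speak of
    truth in V_b for b in R. The gap closes because T(l) records truth in V_l, which is truth in V_k
    by elementarity, and coherence passes this agreement on to V_b for formulas with two parameters.
    In A8 the set A need not lie in V_κ and so cannot be a parameter of T; describability therefore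
    quantifies over A. *)

Definition witness (A : Type) (P : A -> Prop) (h : exists x, P x) : A :=
  proj1_sig (constructive_indefinite_description P h).

Lemma witness_spec (A : Type) (P : A -> Prop) (h : exists x, P x) :
  P (witness h).
Proof. exact (proj2_sig (constructive_indefinite_description P h)). Qed.

Lemma choice_on (A B : Type) (b : B) (Q : A -> Prop) (S : A -> B -> Prop) :
  (forall x, Q x -> exists y, S x y) -> exists f, forall x, Q x -> S x (f x).
Proof.
  intros h.
  assert (H : forall x, exists y, Q x -> S x y).
  { intros x. destruct (classic (Q x)) as [q | q].
    - destruct (h x q) as [y hy]. exists y; auto.
    - exists b; tauto. }
  exists (fun x => witness (H x)). intros x. exact (witness_spec (H x)).
Qed.

(** * Formulas *)

Definition nat_pair (m n : nat) : nat := to_nat (m, n).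

Lemma nat_pair_inj m n m' n' :
  nat_pair m n = nat_pair m' n' -> m = m' /\ n = n'.
Proof.
  intros h. apply (f_equal of_nat) in h. unfold nat_pair in h.
  rewrite !cancel_of_to in h. now injection h.
Qed.

(** Only injectivity matters: it lets formulas index the coordinates of the data attached to an
    ordinal, with a numeral as the tag. *)
Fixpoint formula_code (p : formula) : nat :=
  match p with
  | fMem i j => nat_pair 0 (nat_pair i j)
  | fEq i j => nat_pair 1 (nat_pair i j)
  | fR i => nat_pair 2 i
  | fBot => nat_pair 3 0
  | fImp p q => nat_pair 4 (nat_pair (formula_code p) (formula_code q))
  | fAll p => nat_pair 5 (formula_code p)
  end.

Lemma formula_code_inj p q : formula_code p = formula_code q -> p = q.
Proof.
  revert q. induction p; intros []; cbn [formula_code]; intros h;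
    apply nat_pair_inj in h as [h h']; try discriminate h;
    try (apply nat_pair_inj in h' as [? ?]); f_equal; auto.
Qed.

Lemma fv_below_le n m p : n <= m -> fv_below n p -> fv_below m p.
Proof.
  revert n m. induction p; simpl; intros n m h; try lia; auto.
  - intros [h1 h2]. eauto.
  - apply IHp. lia.
Qed.

Lemma fv_below_exists p : exists n, fv_below n p.
Proof.
  induction p as [i j | i j | i | | p [n hn] q [m hm] | p [n hn]].
  - exists (S (i + j)). simpl. lia.
  - exists (S (i + j)). simpl. lia.
  - exists (S i). simpl. lia.
  - now exists 0.
  - exists (n + m). split; [apply (@fv_below_le n) | apply (@fv_below_le m)]; auto; lia.
  - exists n. apply (@fv_below_le n (S n) p); auto.
Qed.

Lemma sat_fv (M : setStruct) (D R : M -> Prop) p n e e' :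
  fv_below n p -> (forall i, i < n -> e i = e' i) ->
  (sat D R p e <-> sat D R p e').
Proof.
  revert n e e'. induction p; simpl; intros n e e' hp he.
  - now rewrite !he by tauto.
  - now rewrite !he by tauto.
  - now rewrite !he by tauto.
  - tauto.
  - rewrite (IHp1 n e e'), (IHp2 n e e') by tauto. tauto.
  - split; intros h x hx; apply (IHp (S n) (scons x e) (scons x e')); auto;
      intros [| i] hi; simpl; auto; apply he; lia.
Qed.

Lemma sat_transport (M N : setStruct) (f : M -> N)
    (D R : M -> Prop) (D' R' : N -> Prop) :
  (forall x, D x -> D' (f x)) ->
  (forall y, D' y -> exists x, D x /\ f x = y) ->
  (forall x y, D x -> D y -> (x ∈ y <-> f x ∈ f y)) ->
  (forall x y, D x -> D y -> f x = f y -> x = y) ->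
  (forall x, D x -> (R x <-> R' (f x))) ->
  forall p e e', (forall i, D (e i)) -> (forall i, e' i = f (e i)) ->
    (sat D R p e <-> sat D' R' p e').
Proof.
  intros hD hD' hm hi hR. induction p; simpl; intros e e' he hf.
  - rewrite !hf. auto.
  - rewrite !hf. split; [congruence | auto].
  - rewrite hf. auto.
  - tauto.
  - rewrite (IHp1 e e'), (IHp2 e e') by auto. tauto.
  - split.
    + intros h y hy. destruct (hD' y hy) as (x & hx & <-).
      apply (IHp (scons x e)); auto; intros [| i]; simpl; auto.
    + intros h x hx. apply (IHp (scons x e) (scons (f x) e')); auto;
        intros [| i]; simpl; auto.
Qed.

Lemma sat_ext (M : setStruct) (D R : M -> Prop) p e e' :
  (forall i, e i = e' i) -> (sat D R p e <-> sat D R p e').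
Proof.
  intros h. now rewrite (functional_extensionality e e' h).
Qed.

Fixpoint rename (f : nat -> nat) (p : formula) : formula :=
  match p with
  | fMem i j => fMem (f i) (f j)
  | fEq i j => fEq (f i) (f j)
  | fR i => fR (f i)
  | fBot => fBot
  | fImp p q => fImp (rename f p) (rename f q)
  | fAll p => fAll (rename (scons 0 (fun i => S (f i))) p)
  end.

Lemma sat_rename (M : setStruct) (D R : M -> Prop) p f e :
  sat D R (rename f p) e <-> sat D R p (fun i => e (f i)).
Proof.
  revert f e. induction p; simpl; intros f e; try tauto.
  - now rewrite IHp1, IHp2.
  - assert (H : forall x, sat D R (rename (scons 0 (fun i => S (f i))) p) (scons x e) <->
      sat D R p (scons x (fun i => e (f i)))).
    { intros x. rewrite IHp. apply sat_ext. now intros [| i]. }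
    split; intros h x hx; apply H; auto.
Qed.

Lemma R_free_rename p f : R_free p -> R_free (rename f p).
Proof.
  revert f. induction p; simpl; auto. intros f [h1 h2]. auto.
Qed.

Lemma fv_below_rename p f n : (forall i, f i < n) -> fv_below n (rename f p).
Proof.
  revert f n. induction p; simpl; intros f n h; auto.
  apply IHp. intros [| i]; simpl; [| specialize (h i)]; lia.
Qed.

(** * Definable predicates *)

(** One formula must serve all structures at once. Predicates stay written in Rocq, and the same
    predicate can be moved between V_l and V_k by elementarity and between a and l by coherence,
    without a formula being spelled out. *)
Definition definable (P : forall M : setStruct, (nat -> M) -> Prop) : Prop :=
  exists p, R_free p /\
    forall (M : setStruct) (e : nat -> M),
      sat (fun _ => True) (@no_pred M) p e <-> P M e.

Lemma definable_ext (P Q : forall M : setStruct, (nat -> M) -> Prop) :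
  definable P -> (forall M e, P M e <-> Q M e) -> definable Q.
Proof.
  intros (p & hp & h) hPQ. exists p. split; auto. intros M e.
  now rewrite h.
Qed.

Lemma definable_mem i j : definable (fun M e => e i ∈ e j).
Proof. exists (fMem i j). now split. Qed.

Lemma definable_eq i j : definable (fun M e => e i = e j).
Proof. exists (fEq i j). now split. Qed.

Lemma definable_False : definable (fun _ _ => False).
Proof. exists fBot. now split. Qed.

Lemma definable_imp (P Q : forall M : setStruct, (nat -> M) -> Prop) :
  definable P -> definable Q -> definable (fun M e => P M e -> Q M e).
Proof.
  intros (p & hp & h) (q & hq & h'). exists (fImp p q). split; [now split |].
  intros M e. simpl. now rewrite h, h'.
Qed.

Lemma definable_all (Q : forall M : setStruct, M -> (nat -> M) -> Prop) :
  definable (fun M e => Q M (e 0) (fun i => e (S i))) ->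
  definable (fun M e => forall x : M, Q M x e).
Proof.
  intros (p & hp & h). exists (fAll p). split; auto. intros M e. simpl.
  split; intros H x; [apply (h M (scons x e)) | intros _; apply (h M (scons x e))];
    auto.
  exact (H x).
Qed.

Lemma definable_not (P : forall M : setStruct, (nat -> M) -> Prop) :
  definable P -> definable (fun M e => ~ P M e).
Proof. intros h. exact (definable_imp h definable_False). Qed.

Lemma definable_and (P Q : forall M : setStruct, (nat -> M) -> Prop) :
  definable P -> definable Q -> definable (fun M e => P M e /\ Q M e).
Proof.
  intros hP hQ.
  refine (definable_ext (definable_not (definable_imp hP (definable_not hQ))) _).
  intros M e. simpl. destruct (classic (P M e)), (classic (Q M e)); tauto.
Qed.

Lemma definable_or (P Q : forall M : setStruct, (nat -> M) -> Prop) :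
  definable P -> definable Q -> definable (fun M e => P M e \/ Q M e).
Proof.
  intros hP hQ. refine (definable_ext (definable_imp (definable_not hP) hQ) _).
  intros M e. simpl. destruct (classic (P M e)); tauto.
Qed.

Lemma definable_iff (P Q : forall M : setStruct, (nat -> M) -> Prop) :
  definable P -> definable Q -> definable (fun M e => P M e <-> Q M e).
Proof.
  intros hP hQ. exact (definable_and (definable_imp hP hQ) (definable_imp hQ hP)).
Qed.

Lemma definable_ex (Q : forall M : setStruct, M -> (nat -> M) -> Prop) :
  definable (fun M e => Q M (e 0) (fun i => e (S i))) ->
  definable (fun M e => exists x : M, Q M x e).
Proof.
  intros h.
  refine (definable_ext (definable_not
    (definable_all (Q := fun M x e => ~ Q M x e) (definable_not h))) _).
  intros M e. split.
  - intros H. now apply not_all_not_ex.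
  - intros (x & hx) H. exact (H x hx).
Qed.

Lemma definable_sat p f : R_free p ->
  definable (fun M e => sat (fun _ => True) (@no_pred M) p (fun n => e (f n))).
Proof.
  intros hp. exists (rename f p). split; [now apply R_free_rename |].
  intros M e. apply sat_rename.
Qed.

(** For a fixed formula, truth in a set needs no internal satisfaction relation: its quantifiers are
    relativized to [e i]. Under a quantifier both the renaming and the index of the bounding set
    shift. *)
Lemma definable_sat_in p f i : R_free p ->
  definable (fun M e => sat (fun x => x ∈ e i) (@no_pred M) p (fun n => e (f n))).
Proof.
  revert f i. induction p; cbn [sat R_free]; intros f k hp.
  - apply definable_mem.
  - apply definable_eq.
  - destruct hp.
  - apply definable_False.
  - destruct hp. apply definable_imp; auto.
  - apply definable_all. apply definable_imp; [apply definable_mem |].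
    refine (definable_ext (IHp (scons 0 (fun i => S (f i))) (S k) hp) _).
    intros M e. apply sat_ext. now intros [| i].
Qed.

Ltac prove_definable :=
  repeat first
    [ apply definable_mem | apply definable_eq | apply definable_False
    | apply definable_all | apply definable_ex | apply definable_and
    | apply definable_or | apply definable_iff | apply definable_not
    | apply definable_imp ].

Lemma definable_is_regular : definable (fun M e => is_regular (e 0)).
Proof.
  unfold is_regular, is_cardinal, is_limit, is_ordinal, is_bijection,
    is_fun_into, is_fun, maps, well_ordered_by_mem, transitive_set, is_opair,
    is_pair, subset, unique.
  prove_definable.
Qed.

(** Truth of [p] in V_a, a = [e 0], at the two components of an ordered pair. The first variable is
    reserved for a, so both parameters travel in the one that remains, [e 1]. *)
Lemma definable_pair_in_V p : R_free p ->
  definable (fun M e => exists v, is_V (e 0) v /\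
    exists x s, is_opair (e 1) x s /\ x ∈ v /\ s ∈ v /\
      sat (fun z => z ∈ v) (@no_pred M) p (scons x (fun _ => s))).
Proof.
  intros hp.
  unfold is_V, is_fun, maps, is_succ, is_opair, is_pair, subset, unique.
  prove_definable.
  (* Innermost binder first: 0 is [s], 1 is [x], 2 is [v]. *)
  refine (definable_ext (definable_sat_in (scons 1 (fun _ => 0)) 2 hp) _).
  intros M e. apply sat_ext. now intros [| i].
Qed.

(** The describing set [A] is quantified: a subset of an ordinal a may have rank a, and then it lies
    outside V_a, from which the parameters of T(a) are taken. *)
Lemma definable_describable p : R_free p ->
  definable (fun M e => exists A, A ⊆ e 0 /\
    sat (fun _ => True) (@no_pred M) p (scons (e 0) (fun _ => A)) /\
    forall l B, l ∈ e 0 -> is_inter B A l ->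
      ~ sat (fun _ => True) (@no_pred M) p (scons l (fun _ => B))).
Proof.
  intros hp. unfold is_inter, subset. prove_definable.
  - refine (definable_ext (definable_sat (scons 1 (fun _ => 0)) hp) _).
    intros M e. apply sat_ext. now intros [| i].
  - refine (definable_ext (definable_sat (scons 1 (fun _ => 0)) hp) _).
    intros M e. apply sat_ext. now intros [| i].
Qed.

(** Assignments of the form (a, s, s, ...) do not distinguish the variables after the first, so all
    of these can be renamed to 1. *)
Lemma definable_formula2 P : definable P ->
  exists p, set_formula2 p /\
    forall (M : setStruct) (a s : M),
      sat (fun _ => True) (@no_pred M) p (scons a (fun _ => s)) <->
      P M (scons a (fun _ => s)).
Proof.
  intros (p & hp & h).
  exists (rename (scons 0 (fun _ => 1)) p). split; [split |].
  - now apply R_free_rename.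
  - apply fv_below_rename. intros [| i]; simpl; lia.
  - intros M a s. rewrite sat_rename, <- h. apply sat_ext. now intros [| i].
Qed.

(** * Ordinals, rank and the cumulative hierarchy *)

Section SetTheory.
Variables (V : setStruct) (hV : ZFC V).
Implicit Types x y z u v a b c : V.

Lemma set_ext x y : (forall z, z ∈ x <-> z ∈ y) -> x = y.
Proof. apply (zf_extensionality hV). Qed.

Definition sep (P : V -> Prop) x : V := witness (zf_separation hV P x).

Lemma in_sep P x z : z ∈ sep P x <-> z ∈ x /\ P z.
Proof. exact (witness_spec (zf_separation hV P x) z). Qed.

Definition pset x : V := witness (zf_power hV x).

Lemma in_pset x z : z ∈ pset x <-> z ⊆ x.
Proof. exact (witness_spec (zf_power hV x) z). Qed.

Definition union x : V := witness (zf_union hV x).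

Lemma in_union x z : z ∈ union x <-> exists y, y ∈ x /\ z ∈ y.
Proof. exact (witness_spec (zf_union hV x) z). Qed.

Definition upair x y : V := witness (zf_pairing hV x y).

Lemma in_upair x y z : z ∈ upair x y <-> z = x \/ z = y.
Proof. exact (witness_spec (zf_pairing hV x y) z). Qed.

Lemma image_exists (F : V -> V) x :
  exists y, forall v, v ∈ y <-> exists u, u ∈ x /\ v = F u.
Proof. apply (zf_replacement hV (F := fun u v => v = F u)). congruence. Qed.

Definition image (F : V -> V) x : V := witness (image_exists F x).

Lemma in_image F x v : v ∈ image F x <-> exists u, u ∈ x /\ v = F u.
Proof. exact (witness_spec (image_exists F x) v). Qed.

Lemma image_eq F G x : (forall u, u ∈ x -> F u = G u) -> image F x = image G x.
Proof.
  intros h. apply set_ext; intro v. rewrite !in_image.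
  split; intros (u & hu & ->); exists u; rewrite ?h; auto;
    split; auto; symmetry; auto.
Qed.

Lemma empty_exists : exists e : V, forall z, ~ z ∈ e.
Proof. destruct (zf_infinity hV) as (x & (z & _ & hz) & _). now exists z. Qed.

Definition empty : V := witness empty_exists.

Lemma not_in_empty z : ~ z ∈ empty.
Proof. exact (witness_spec empty_exists z). Qed.

Definition cup x y := union (upair x y).

Lemma in_cup x y z : z ∈ cup x y <-> z ∈ x \/ z ∈ y.
Proof.
  unfold cup. rewrite in_union. split.
  - intros (w & hw & hz). apply in_upair in hw as [-> | ->]; auto.
  - intros [h | h]; [exists x | exists y]; rewrite in_upair; auto.
Qed.

Definition sing x := upair x x.

Lemma in_sing x z : z ∈ sing x <-> z = x.
Proof. unfold sing. rewrite in_upair. tauto. Qed.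

Definition succ x := cup x (sing x).

Lemma in_succ x z : z ∈ succ x <-> z ∈ x \/ z = x.
Proof. unfold succ. now rewrite in_cup, in_sing. Qed.

Lemma is_succ_iff y x : is_succ y x <-> y = succ x.
Proof.
  split.
  - intros h. apply set_ext; intro z. now rewrite in_succ, (h z).
  - intros -> z. apply in_succ.
Qed.

Definition opair x y := upair (sing x) (upair x y).

Lemma sing_inj x y : sing x = sing y -> x = y.
Proof. intros h. apply in_sing. rewrite <- h. now apply in_sing. Qed.

Lemma opair_inj x y x' y' : opair x y = opair x' y' -> x = x' /\ y = y'.
Proof.
  unfold opair. intros h.
  assert (hx : x = x').
  { assert (h1 : sing x ∈ upair (sing x') (upair x' y'))
      by (rewrite <- h, in_upair; auto).
    apply in_upair in h1 as [h1 | h1]; [now apply sing_inj |].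
    symmetry; apply in_sing. rewrite h1, in_upair. auto. }
  subst x'. split; [reflexivity |].
  assert (h1 : upair x y ∈ upair (sing x) (upair x y'))
    by (rewrite <- h, in_upair; auto).
  assert (h2 : upair x y' ∈ upair (sing x) (upair x y))
    by (rewrite h, in_upair; auto).
  assert (hy : y ∈ upair x y) by (rewrite in_upair; auto).
  assert (hy' : y' ∈ upair x y') by (rewrite in_upair; auto).
  apply in_upair in h1 as [h1 | h1]; rewrite h1 in hy.
  - apply in_sing in hy; subst y.
    apply in_upair in h2 as [h2 | h2]; rewrite h2 in hy'.
    + symmetry; now apply in_sing in hy'.
    + apply in_upair in hy' as [-> | ->]; auto.
  - apply in_upair in hy as [-> | ->]; auto.
    apply in_upair in h2 as [h2 | h2]; rewrite h2 in hy'.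
    + symmetry; now apply in_sing in hy'.
    + apply in_upair in hy' as [-> | ->]; auto.
Qed.

Lemma is_pair_iff p x y : is_pair p x y <-> p = upair x y.
Proof.
  split.
  - intros h. apply set_ext; intro z. now rewrite in_upair, (h z).
  - intros -> z. apply in_upair.
Qed.

Lemma is_opair_iff p x y : is_opair p x y <-> p = opair x y.
Proof.
  unfold is_opair. split.
  - intros (u & v & hu & hv & hp). apply is_pair_iff in hu, hv, hp. now subst.
  - intros ->. exists (sing x), (upair x y). now rewrite !is_pair_iff.
Qed.

Lemma maps_iff f x y : maps f x y <-> opair x y ∈ f.
Proof.
  unfold maps. split.
  - intros (p & hp & h). apply is_opair_iff in hp. now subst.
  - intros h. exists (opair x y). now rewrite is_opair_iff.
Qed.

Definition graph (F : V -> V) x := image (fun u => opair u (F u)) x.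

Lemma maps_graph F x u v : maps (graph F x) u v <-> u ∈ x /\ v = F u.
Proof.
  unfold graph. rewrite maps_iff, in_image. split.
  - intros (w & hw & h). apply opair_inj in h as [-> ->]. auto.
  - intros [hu ->]. exists u; auto.
Qed.

Lemma graph_is_fun F x : is_fun (graph F x) x.
Proof.
  split.
  - intros p hp. apply in_image in hp as (u & hu & ->).
    exists u, (F u). now rewrite is_opair_iff.
  - intros u hu. exists (F u). split; [now rewrite maps_graph |].
    intros v hv. apply maps_graph in hv as [_ ->]. reflexivity.
Qed.

Lemma mem_irrefl x : ~ x ∈ x.
Proof.
  intros h. destruct (zf_foundation hV (x := sing x)) as (y & hy & hn).
  - exists x. now apply in_sing.
  - apply in_sing in hy; subst y. apply hn. exists x. now rewrite in_sing.
Qed.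

Fixpoint num (n : nat) : V :=
  match n with 0 => empty | S m => succ (num m) end.

Lemma num_lt n m : n < m -> num n ∈ num m.
Proof.
  induction 1; simpl; rewrite in_succ; auto.
Qed.

Lemma num_inj n m : num n = num m -> n = m.
Proof.
  intros h. destruct (lt_eq_lt_dec n m) as [[l | l] | l]; auto;
    apply num_lt in l; rewrite h in l; now apply mem_irrefl in l.
Qed.

(** Separation accepts every predicate of the ambient logic, so omega consists of exactly the
    standard numerals, and sequences over [nat] become sets. *)
Lemma omega_exists : exists w : V, forall z, z ∈ w <-> exists n, z = num n.
Proof.
  destruct (zf_infinity hV) as (x & (e & he & hz) & hs).
  assert (hn : forall n, num n ∈ x).
  { induction n; simpl.
    - replace empty with e; auto. apply set_ext; intro z.
      split; intro h; [now apply hz in h | now apply not_in_empty in h].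
    - destruct (hs _ IHn) as (z & hz' & h). apply is_succ_iff in hz'.
      now subst. }
  exists (sep (fun z => exists n, z = num n) x). intro z. rewrite in_sep.
  split; [tauto |]. intros (n & ->). eauto.
Qed.

Definition omega : V := witness omega_exists.

Lemma in_omega z : z ∈ omega <-> exists n, z = num n.
Proof. exact (witness_spec omega_exists z). Qed.

Fixpoint iter_union (n : nat) x : V :=
  match n with 0 => x | S m => union (iter_union m x) end.

Lemma nat_image (F : nat -> V) : exists s, forall z, z ∈ s <-> exists n, z = F n.
Proof.
  destruct (zf_replacement hV (F := fun u v => exists n, u = num n /\ v = F n)
              (x := omega)) as (s & hs).
  - intros u v w _ (n & -> & ->) (m & h & ->). apply num_inj in h. now subst.
  - exists s. intro z. rewrite hs. split.
    + intros (u & _ & n & _ & h). eauto.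
    + intros (n & ->). exists (num n). rewrite in_omega. eauto.
Qed.

Lemma transitive_closure_exists x : exists t, x ⊆ t /\ transitive_set t.
Proof.
  destruct (nat_image (fun n => iter_union n x)) as (s & hs).
  exists (union s). split.
  - intros z hz. apply in_union. exists x. split; auto. apply hs. now exists 0.
  - intros y hy z hz. apply in_union in hy as (w & hw & hy).
    apply hs in hw as (n & ->). apply in_union.
    exists (iter_union (S n) x). split; [apply hs; eauto |].
    simpl. apply in_union; eauto.
Qed.

(** The elements of a transitive closure that are not accessible form a set by separation, and
    foundation would give it a minimal element. *)
Lemma mem_wf : well_founded (@mem V).
Proof.
  intros x. apply NNPP. intros hx.
  destruct (transitive_closure_exists (sing x)) as (t & ht & htr).
  destruct (zf_foundation hV (x := sep (fun z => ~ Acc (@mem V) z) t))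
    as (y & hy & hn).
  - exists x. rewrite in_sep. split; auto. apply ht. now apply in_sing.
  - apply in_sep in hy as [hy hy']. apply hy'. constructor. intros z hz.
    apply NNPP. intros hz'. apply hn. exists z. rewrite in_sep.
    split; auto. split; auto. eapply htr; eauto.
Qed.

Lemma least_exists (P : V -> Prop) :
  (exists x, P x) -> exists x, P x /\ forall y, y ∈ x -> ~ P y.
Proof.
  intros (x & hx). revert hx. induction (mem_wf x) as [x _ IH]. intros hx.
  destruct (classic (exists y, y ∈ x /\ P y)) as [(y & hy & hP) | h].
  - eauto.
  - exists x. split; auto. intros y hy hP. apply h; eauto.
Qed.

Lemma mem_recursion (step : V -> (V -> V) -> V) :
  (forall x f g, (forall y, y ∈ x -> f y = g y) -> step x f = step x g) ->
  exists f, forall x, f x = step x f.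
Proof.
  intros hext.
  set (body := fun x (rec : forall y, y ∈ x -> V) =>
    (* [step] expects a total function; the value [empty] off [x] is harmless by [hext]. *)
    step x (fun y => match excluded_middle_informative (y ∈ x) with
                     | left h => rec y h | right _ => empty end)).
  exists (Fix mem_wf (fun _ => carrier V) body).
  intros x. rewrite Fix_eq.
  - unfold body at 1. apply hext. intros y hy.
    destruct (excluded_middle_informative (y ∈ x)); tauto.
  - intros y f g h. unfold body. apply hext. intros z hz.
    destruct (excluded_middle_informative (z ∈ y)); auto.
Qed.

(** In the presence of foundation, hereditary transitivity is enough; [is_ordinal_iff] links it to
    the well-order form. *)
Definition ord a := transitive_set a /\ forall x, x ∈ a -> transitive_set x.

Lemma ord_mem a x : ord a -> x ∈ a -> ord x.
Proof.
  intros [ht he] hx. split; auto. intros y hy. apply he. eapply ht; eauto.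
Qed.

Lemma ord_trans a x y : ord a -> x ∈ a -> y ∈ x -> y ∈ a.
Proof. intros [ht _] hx hy. eapply ht; eauto. Qed.

Lemma ord_trichotomy a b : ord a -> ord b -> a ∈ b \/ a = b \/ b ∈ a.
Proof.
  revert b. induction (mem_wf a) as [a _ IHa]. intros b ha.
  induction (mem_wf b) as [b _ IHb]. intros hb.
  destruct (classic (b ∈ a)) as [h | nba]; auto.
  destruct (classic (a ∈ b)) as [h | nab]; auto.
  right; left. apply set_ext; intro z. split; intro hz.
  - destruct (IHa z hz b (ord_mem ha hz) hb) as [h | [-> | h]]; auto; try tauto.
    exfalso. apply nba. eapply ord_trans; eauto.
  - destruct (IHb z hz (ord_mem hb hz)) as [h | [-> | h]]; auto; try tauto.
    exfalso. apply nab. eapply ord_trans; eauto.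
Qed.

Lemma ord_not_mem a b : ord a -> ord b -> (~ a ∈ b <-> b ⊆ a).
Proof.
  intros ha hb. split.
  - intros h. destruct (ord_trichotomy ha hb) as [h' | [-> | h']].
    + tauto.
    + intros z; auto.
    + intros z hz. eapply ord_trans; eauto.
  - intros h h'. apply h in h'. now apply mem_irrefl in h'.
Qed.

Lemma ord_sub_mem a b c : ord c -> a ⊆ b -> ord a -> b ∈ c -> a ∈ c.
Proof.
  intros hc hab ha hb.
  destruct (ord_trichotomy ha (ord_mem hc hb)) as [h | [-> | h]]; auto.
  - eapply ord_trans; eauto.
  - apply hab in h. now apply mem_irrefl in h.
Qed.

Lemma ord_sub_cases a b : ord a -> ord b -> a ⊆ b -> a = b \/ a ∈ b.
Proof.
  intros ha hb h. destruct (ord_trichotomy ha hb) as [h' | [h' | h']]; auto.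
  apply h in h'. now apply mem_irrefl in h'.
Qed.

Lemma is_ordinal_iff a : is_ordinal a <-> ord a.
Proof.
  split.
  - intros (ht & _ & htr & _). split; auto. intros x hx y hy z hz.
    assert (hya : y ∈ a) by exact (ht x hx y hy).
    exact (htr z y x (ht y hya z hz) hya hx hz hy).
  - intros ha. split; [exact (proj1 ha) |]. split; [| split; [| split]].
    + intros x _. apply mem_irrefl.
    + intros x y z _ _ hz hxy hyz. apply (ord_trans (ord_mem ha hz) hyz hxy).
    + intros x y hx hy. apply ord_trichotomy; eapply ord_mem; eauto.
    + intros b hb hne. destruct (least_exists hne) as (x & hx & hmin).
      exists x. split; auto. intros y hy.
      destruct (ord_trichotomy (ord_mem ha (hb _ hx)) (ord_mem ha (hb _ hy)))
        as [h | [h | h]]; auto. exfalso. eapply hmin; eauto.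
Qed.

Lemma ord_of_ords x : (forall y, y ∈ x -> ord y) -> transitive_set x -> ord x.
Proof. intros h ht. split; auto. intros y hy. exact (proj1 (h y hy)). Qed.

Lemma ord_union x : (forall y, y ∈ x -> ord y) -> ord (union x).
Proof.
  intros h. apply ord_of_ords.
  - intros y hy. apply in_union in hy as (z & hz & hy).
    eapply ord_mem; [apply h |]; eauto.
  - intros y hy z hz. apply in_union in hy as (w & hw & hy).
    apply in_union. exists w. split; auto. eapply ord_trans; eauto.
Qed.

Lemma ord_cup a b : ord a -> ord b -> ord (cup a b).
Proof.
  intros ha hb. apply ord_union. intros y hy.
  apply in_upair in hy as [-> | ->]; auto.
Qed.

Lemma ord_succ a : ord a -> ord (succ a).
Proof.
  intros ha. apply ord_of_ords.
  - intros y hy. apply in_succ in hy as [hy | ->]; auto. eapply ord_mem; eauto.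
  - intros y hy z hz. apply in_succ.
    apply in_succ in hy as [hy | ->]; auto. left. eapply ord_trans; eauto.
Qed.

Lemma ord_num n : ord (num n).
Proof.
  induction n; simpl; [| now apply ord_succ].
  apply ord_of_ords; intros y hy; now apply not_in_empty in hy.
Qed.

Lemma in_num n z : z ∈ num n <-> exists m, m < n /\ z = num m.
Proof.
  split.
  - induction n; simpl; intros h; [now apply not_in_empty in h |].
    apply in_succ in h as [h | ->].
    + destruct (IHn h) as (m & hm & ->). exists m. split; auto.
    + exists n; auto.
  - intros (m & h & ->). now apply num_lt.
Qed.

Lemma ord_omega : ord omega.
Proof.
  apply ord_of_ords.
  - intros y hy. apply in_omega in hy as (n & ->). apply ord_num.
  - intros y hy z hz. apply in_omega in hy as (n & ->).
    apply in_num in hz as (m & _ & ->). apply in_omega; eauto.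
Qed.

Lemma num_in_omega n : num n ∈ omega.
Proof. apply in_omega. eauto. Qed.

Lemma succ_sub a b : ord b -> a ∈ b -> succ a ⊆ b.
Proof.
  intros hb h z hz. apply in_succ in hz as [hz | ->]; auto.
  eapply ord_trans; eauto.
Qed.

Lemma cup_in a b c : ord c -> a ∈ c -> b ∈ c -> cup a b ∈ c.
Proof.
  intros hc ha hb. assert (oa := ord_mem hc ha). assert (ob := ord_mem hc hb).
  destruct (classic (a ∈ b)) as [h | h].
  - apply ord_sub_mem with b; auto using ord_cup.
    intros z hz. apply in_cup in hz as [hz | hz]; auto. eapply ord_trans; eauto.
  - apply ord_sub_mem with a; auto using ord_cup.
    intros z hz. apply in_cup in hz as [hz | hz]; auto.
    apply (proj1 (ord_not_mem oa ob) h); auto.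
Qed.

Lemma rk_exists : exists r : V -> V, forall x, r x = union (image (fun y => succ (r y)) x).
Proof.
  apply (mem_recursion (step := fun x r => union (image (fun y => succ (r y)) x))).
  intros x f g h. f_equal. apply image_eq. intros y hy. now rewrite h.
Qed.

Definition rk : V -> V := witness rk_exists.

Lemma in_rk x z : z ∈ rk x <-> exists y, y ∈ x /\ (z ∈ rk y \/ z = rk y).
Proof.
  unfold rk at 1. rewrite (witness_spec rk_exists x). fold rk.
  rewrite in_union. split.
  - intros (w & hw & hz). apply in_image in hw as (y & hy & ->).
    exists y. now rewrite in_succ in hz.
  - intros (y & hy & hz). exists (succ (rk y)). rewrite in_succ, in_image.
    split; eauto.
Qed.

Lemma ord_rk x : ord (rk x).
Proof.
  induction (mem_wf x) as [x _ IH]. apply ord_of_ords.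
  - intros z hz. apply in_rk in hz as (y & hy & [hz | ->]); auto.
    eapply ord_mem; eauto.
  - intros z hz w hw. apply in_rk in hz as (y & hy & [hz | ->]); apply in_rk;
      exists y; split; auto. left. eapply ord_trans; eauto.
Qed.

Lemma rk_mem x y : y ∈ x -> rk y ∈ rk x.
Proof. intros h. apply in_rk. eauto. Qed.

Lemma rk_sub x a : ord a -> (forall y, y ∈ x -> rk y ∈ a) -> rk x ⊆ a.
Proof.
  intros ha h z hz. apply in_rk in hz as (y & hy & [hz | ->]); auto.
  eapply ord_trans; eauto.
Qed.

Lemma rk_mono x y : x ⊆ y -> rk x ⊆ rk y.
Proof. intros h. apply rk_sub; [apply ord_rk |]. intros z hz. apply rk_mem, h, hz. Qed.

Lemma rk_ord a : ord a -> rk a = a.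
Proof.
  induction (mem_wf a) as [a _ IH]. intros ha. apply set_ext; intro z.
  rewrite in_rk. split.
  - intros (y & hy & hz). rewrite IH in hz; eauto using ord_mem.
    destruct hz as [hz | ->]; auto. eapply ord_trans; eauto.
  - intros hz. exists z. rewrite IH; eauto using ord_mem.
Qed.

Lemma Vf_exists :
  exists f : V -> V, forall a, f a = union (image (fun b => pset (f b)) a).
Proof.
  apply (mem_recursion (step := fun a f => union (image (fun b => pset (f b)) a))).
  intros x f g h. f_equal. apply image_eq. intros y hy. now rewrite h.
Qed.

Definition Vf : V -> V := witness Vf_exists.

Lemma in_Vf_unfold a x : x ∈ Vf a <-> exists b, b ∈ a /\ x ⊆ Vf b.
Proof.
  unfold Vf at 1. rewrite (witness_spec Vf_exists a). fold Vf.
  rewrite in_union. split.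
  - intros (w & hw & hz). apply in_image in hw as (y & hy & ->).
    exists y. now rewrite in_pset in hz.
  - intros (y & hy & hz). exists (pset (Vf y)). rewrite in_pset, in_image.
    split; eauto.
Qed.

Lemma in_Vf a x : ord a -> (x ∈ Vf a <-> rk x ∈ a).
Proof.
  revert x. induction (mem_wf a) as [a _ IH]. intros x ha.
  rewrite in_Vf_unfold. split.
  - intros (b & hb & h). assert (ob := ord_mem ha hb).
    apply ord_sub_mem with b; auto using ord_rk.
    apply rk_sub; auto. intros y hy. apply IH; auto.
  - intros h. exists (rk x). split; auto. intros y hy.
    apply IH; auto using ord_rk, rk_mem.
Qed.

Lemma rk_subset_in x y a : ord a -> x ⊆ y -> rk y ∈ a -> rk x ∈ a.
Proof.
  intros ha h. apply ord_sub_mem; auto using ord_rk, rk_mono.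
Qed.

(** Makes V_a contain all numerals and be closed under ordered pairs, so that it holds the tagged
    pairs (i, x) used for coding. *)
Definition limit_above_omega a :=
  ord a /\ omega ∈ a /\ forall x, x ∈ a -> succ x ∈ a.

Lemma rk_upair x y a :
  ord a -> (forall z, z ∈ a -> succ z ∈ a) ->
  rk x ∈ a -> rk y ∈ a -> rk (upair x y) ∈ a.
Proof.
  intros ha hs hx hy.
  assert (hc : succ (cup (rk x) (rk y)) ∈ a) by (apply hs, cup_in; auto).
  apply ord_sub_mem with (succ (cup (rk x) (rk y))); auto using ord_rk.
  apply rk_sub; [eapply ord_mem; eauto |].
  assert (hsub : forall w, ord w -> w ⊆ cup (rk x) (rk y) ->
            w ∈ succ (cup (rk x) (rk y))).
  { intros w hw h. apply in_succ.
    destruct (ord_sub_cases hw (ord_cup (ord_rk x) (ord_rk y)) h); auto. }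
  intros z hz. apply in_upair in hz as [-> | ->]; apply hsub; auto using ord_rk;
    intros w hw; apply in_cup; auto.
Qed.

Lemma rk_opair x y a :
  ord a -> (forall z, z ∈ a -> succ z ∈ a) ->
  rk x ∈ a -> rk y ∈ a -> rk (opair x y) ∈ a.
Proof.
  intros ha hs hx hy. unfold opair, sing. repeat apply rk_upair; auto.
Qed.

(** * Subtle cardinals are inaccessible *)

(** Here [x] may be any set of rank below k, for instance a power set, so the second clause contains
    both regularity and the strong limit property. *)
Record inaccessible k : Prop := {
  inac_limit : limit_above_omega k;
  inac_bounded : forall x (F : V -> V), rk x ∈ k ->
    (forall u, u ∈ x -> F u ∈ k) ->
    exists b, b ∈ k /\ forall u, u ∈ x -> F u ∈ b
}.

Lemma subtle_ord k : is_subtle k -> ord k.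
Proof. intros hk. apply is_ordinal_iff. exact (proj1 (proj1 hk)). Qed.

Lemma subtle_coherent_pair k (hk : is_subtle k) (C : V -> Prop) (A : V -> V -> Prop) :
  (forall x, x ∈ k -> exists y, y ∈ k /\ C y /\ (x = y \/ x ∈ y)) ->
  (forall x, x ∈ k -> (exists y, y ∈ x) ->
     (forall y, y ∈ x -> exists z, C z /\ z ∈ x /\ y ∈ z) -> C x) ->
  exists a b, b ∈ k /\ C a /\ C b /\ a ∈ b /\
    forall x, x ∈ a -> (A a x <-> A b x).
Proof.
  intros hunb hcl. assert (ok := subtle_ord hk).
  destruct hk as [_ hs].
  destruct (hs (sep C k) (graph (fun d => sep (A d) d) (sep C k)))
    as (a & b & Aa & Ab & ha & hb & hab & hAa & hAb & hi).
  - split; [| split].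
    + intros x hx. now apply in_sep in hx.
    + intros x hx. destruct (hunb x hx) as (y & hy & hC & h).
      exists y. now rewrite in_sep.
    + intros x hx hne h. apply in_sep. split; auto. apply hcl; auto.
      intros y hy. destruct (h y hy) as (z & hz & h'). exists z.
      apply in_sep in hz. tauto.
  - apply graph_is_fun.
  - intros d Ad hd x hx. apply maps_graph in hd as [_ ->].
    now apply in_sep in hx.
  - apply in_sep in ha, hb. exists a, b. repeat split; try tauto.
    + intros h. apply maps_graph in hAa as [_ ->], hAb as [_ ->].
      assert (h' : x ∈ sep (A a) a) by now apply in_sep.
      apply hi in h' as [h' _]. now apply in_sep in h'.
    + intros h. apply maps_graph in hAa as [_ ->], hAb as [_ ->].
      assert (h' : x ∈ sep (A a) a).
      { apply hi. split; auto. apply in_sep. split; auto.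
        eapply ord_trans; eauto. eapply ord_mem; eauto. tauto. }
      now apply in_sep in h'.
Qed.

Lemma subtle_nonempty k : is_subtle k -> exists x, x ∈ k.
Proof.
  intros hk.
  destruct (@subtle_coherent_pair k hk (fun _ => True) (fun _ _ => True))
    as (a & b & hb & _); eauto.
Qed.

(** If k were the successor of m, then {m} would be a club, unbounded because unboundedness is
    stated with <=, and it has no two elements. *)
Lemma subtle_succ k : is_subtle k -> forall x, x ∈ k -> succ x ∈ k.
Proof.
  intros hk m hm. assert (ok := subtle_ord hk).
  assert (om := ord_mem ok hm).
  destruct (ord_sub_cases (ord_succ om) ok (succ_sub ok hm)) as [e | h]; auto.
  exfalso.
  destruct (@subtle_coherent_pair k hk (fun x => x = m) (fun _ _ => True))
    as (a & b & hb & -> & -> & h & _).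
  - intros x hx. exists m. rewrite <- e, in_succ in hx. tauto.
  - intros x hx (y & hy) h. destruct (h y hy) as (z & -> & hz & _).
    exfalso. rewrite <- e, in_succ in hx. destruct hx as [hx | ->].
    + apply (mem_irrefl (x := m)). eapply ord_trans; eauto.
    + now apply mem_irrefl in hz.
  - now apply mem_irrefl in h.
Qed.

Lemma ord_sub_omega k :
  ord k -> (exists x, x ∈ k) -> (forall x, x ∈ k -> succ x ∈ k) -> omega ⊆ k.
Proof.
  intros ok (x & hx) hs z hz. apply in_omega in hz as (n & ->).
  induction n; simpl; auto.
  apply ord_sub_mem with x; auto.
  - intros z hz; now apply not_in_empty in hz.
  - exact (ord_num 0).
Qed.

(* On omega, the sets A_(n+1) = n are pairwise incoherent. *)
Lemma subtle_omega k : is_subtle k -> omega ∈ k.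
Proof.
  intros hk. assert (ok := subtle_ord hk).
  destruct (ord_sub_cases ord_omega ok) as [e | h]; auto.
  { apply ord_sub_omega; auto using subtle_nonempty, subtle_succ. }
  exfalso.
  destruct (@subtle_coherent_pair k hk (fun x => exists n, x = num (S n))
              (fun a x => succ x ∈ a))
    as (a & b & hb & (n & ->) & (m & ->) & hab & h).
  - intros x hx. rewrite <- e in hx. apply in_omega in hx as (n & ->).
    exists (num (S n)). rewrite <- e, in_omega. repeat split; eauto.
    right. simpl. rewrite in_succ. auto.
  - intros x hx (y & hy) _. rewrite <- e in hx. apply in_omega in hx as ([| n] & ->).
    + now apply not_in_empty in hy.
    + eauto.
  (* The two sets disagree at the point [num n]: the larger index has it, the smaller one does
     not. *)
  - apply (mem_irrefl (x := num (S n))). change (succ (num n) ∈ num (S n)).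
    apply h.
    + simpl. rewrite in_succ. auto.
    + exact hab.
Qed.

Lemma subtle_limit k : is_subtle k -> limit_above_omega k.
Proof.
  intros hk. repeat split; auto using subtle_omega.
  - exact (proj1 (subtle_ord hk)).
  - exact (proj2 (subtle_ord hk)).
  - now apply subtle_succ.
Qed.

(* If F were unbounded, let a_g be a subset c of m with F c >= g and F c least;
   the a_g are distinct on the club of g closed under g |-> F a_g. *)
Lemma subtle_bounded_on_subsets k (hk : is_subtle k) m (F : V -> V) :
  m ∈ k -> (forall c, c ⊆ m -> F c ∈ k) ->
  exists b, b ∈ k /\ forall c, c ⊆ m -> F c ∈ b.
Proof.
  intros hm hF. destruct (subtle_limit hk) as (ok & hw & hsucc).
  apply NNPP. intros hn.
  assert (hex : forall g, g ∈ k -> exists c, (c ⊆ m /\ ~ F c ∈ g) /\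
             forall d, d ⊆ m -> ~ F d ∈ g -> ~ F d ∈ F c).
  { intros g hg.
    destruct (least_exists (P := fun v => exists c, c ⊆ m /\ ~ F c ∈ g /\ v = F c))
      as (v & (c & hc & hcg & ->) & hmin).
    - apply NNPP. intros h. apply hn. exists g. split; auto. intros c hc.
      apply NNPP. intros h'. apply h. eauto.
    - exists c. split; auto. intros d hd hdg h. eapply hmin; eauto. }
  destruct (choice_on empty hex) as (s & hs).
  assert (hFs : forall g, g ∈ k -> F (s g) ∈ k).
  { intros g hg. apply hF, hs, hg. }
  destruct (@subtle_coherent_pair k hk
              (fun g => m ∈ g /\ forall e, e ∈ g -> F (s e) ∈ g)
              (fun g x => x ∈ s g))
    as (a & b & hb & (hma & _) & (hmb & hcb) & hab & h).
  - intros x hx. pose (n := cup x m).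
    assert (hnk : n ∈ k) by (apply cup_in; auto).
    destruct (hs n hnk) as [[_ hn1] _].
    assert (on := ord_mem ok hnk). assert (oF := ord_mem ok (hFs n hnk)).
    apply ord_not_mem in hn1; auto.
    assert (hle : forall y, y ∈ k -> y ⊆ n -> y ∈ succ (F (s n))).
    { intros y hy h. apply in_succ. assert (oy := ord_mem ok hy).
      destruct (ord_sub_cases oy oF) as [-> | h']; auto.
      intros z hz; auto. }
    (* For e <= [F (s n)] the set [s n] is itself a candidate at e, so leastness gives [F (s e)] <=
       [F (s n)]; hence the successor is a closure point. *)
    exists (succ (F (s n))). split; [auto |]. split; [split |].
    + apply hle; auto. intros z hz. apply in_cup; auto.
    + intros e he.
      assert (hek : e ∈ k) by exact (ord_trans ok (hsucc _ (hFs n hnk)) he).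
      assert (oe := ord_mem ok hek).
      destruct (hs e hek) as [[_ _] hmin].
      assert (h1 : ~ F (s n) ∈ F (s e)).
      { apply hmin; [apply hs; auto |]. intros h1.
        apply in_succ in he as [he | ->].
        - apply (mem_irrefl (x := e)). eapply ord_trans; eauto.
        - now apply mem_irrefl in h1. }
      apply ord_not_mem in h1; eauto using ord_mem.
      apply in_succ. assert (oe' := ord_mem ok (hFs e hek)).
      destruct (ord_sub_cases oe' oF h1) as [-> | h']; auto.
    + right. apply hle; auto. intros z hz. apply in_cup; auto.
  - intros x hx (y & hy) h. assert (ox := ord_mem ok hx). split.
    + destruct (h y hy) as (z & [hz _] & hzx & _). eapply ord_trans; eauto.
    + intros e he. destruct (h e he) as (z & [_ hz] & hzx & hez).
      eapply ord_trans; eauto.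
  - assert (ob := ord_mem ok hb).
    assert (oa := ord_mem ob hab).
    assert (hak : a ∈ k) by (eapply ord_trans; eauto).
    destruct (hs a hak) as [[hsa _] _]. destruct (hs b hb) as [[hsb hsb'] _].
    (* Both chosen sets are subsets of [m], which lies below [a], so coherence makes them equal. But
       [F (s a)] is in [b] by closure, and [F (s b)] is not. *)
    apply hsb'. replace (s b) with (s a); auto. apply set_ext; intro z. split.
    + intros hz. apply h; auto. eapply ord_trans; eauto.
    + intros hz. apply h; auto. eapply ord_trans; eauto.
Qed.

(** Elements of the ordinal [m] are among its subsets; the other subsets are sent to [omega], a
    harmless value below k. *)
Lemma subtle_bounded_on_ordinal k (hk : is_subtle k) m (F : V -> V) :
  m ∈ k -> (forall u, u ∈ m -> F u ∈ k) ->
  exists b, b ∈ k /\ forall u, u ∈ m -> F u ∈ b.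
Proof.
  intros hm hF. destruct (subtle_limit hk) as (ok & hw & _).
  destruct (@subtle_bounded_on_subsets k hk m
    (fun u => if excluded_middle_informative (u ∈ m) then F u else omega))
    as (b & hb & h); auto.
  - intros c _. destruct (excluded_middle_informative (c ∈ m)); auto.
  - exists b. split; auto. intros u hu.
    assert (om := ord_mem ok hm).
    specialize (h u (proj1 om u hu)).
    destruct (excluded_middle_informative (u ∈ m)); tauto.
Qed.

(** * Positions of sets in a global well-order, and the inaccessibility of k *)

Definition new_of_least_rank (a : V) (H : V -> V) x : Prop :=
  ~ x ∈ image H a /\ forall y, ~ y ∈ image H a -> rk x ⊆ rk y.

Lemma new_of_least_rank_exists a H : exists x, new_of_least_rank a H x.
Proof.
  destruct (least_exists (P := fun r => exists x, ~ x ∈ image H a /\ r = rk x))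
    as (r & (x & hx & ->) & hmin).
  - exists (rk (image H a)), (image H a). split; auto. apply mem_irrefl.
  - exists x. split; auto. intros y hy. apply ord_not_mem; auto using ord_rk.
    intros h. eapply hmin; eauto.
Qed.

(* A well-order of the universe compatible with rank. *)
Lemma rank_enumeration_exists : exists H : V -> V, forall a, new_of_least_rank a H (H a).
Proof.
  destruct (mem_recursion
    (step := fun a H => witness (new_of_least_rank_exists a H))) as (H & hH).
  - intros a f g h.
    (* The recursion requires the chosen set to depend only on values below [a]: the two predicates
       are equal, and proof irrelevance then makes the choices equal. *)
    assert (e : new_of_least_rank a f = new_of_least_rank a g).
    { unfold new_of_least_rank. now rewrite (image_eq h). }
    unfold witness. generalize (new_of_least_rank_exists a f)
      (new_of_least_rank_exists a g). rewrite e. intros p q.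
    now rewrite (proof_irrelevance _ p q).
  - exists H. intro a. rewrite (hH a).
    apply (witness_spec (new_of_least_rank_exists a H)).
Qed.

Definition enum : V -> V := witness rank_enumeration_exists.

Lemma enum_spec a : new_of_least_rank a enum (enum a).
Proof. exact (witness_spec rank_enumeration_exists a). Qed.

Lemma enum_neq a b : b ∈ a -> enum b <> enum a.
Proof.
  intros h e. apply (proj1 (enum_spec a)). apply in_image. eauto.
Qed.

Lemma enum_inj a b : ord a -> ord b -> enum a = enum b -> a = b.
Proof.
  intros ha hb e. destruct (ord_trichotomy ha hb) as [h | [h | h]]; auto;
    apply enum_neq in h; congruence.
Qed.

Lemma enum_rk_mono a b : ord b -> a ∈ b -> rk (enum a) ⊆ rk (enum b).
Proof.
  intros hb hab. apply (proj2 (enum_spec a)). intros h.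
  apply (proj1 (enum_spec b)). apply in_image in h as (u & hu & e).
  apply in_image. exists u. split; auto. eapply ord_trans; eauto.
Qed.

Lemma no_set_of_ordinals s : exists a, ord a /\ ~ a ∈ s.
Proof.
  exists (rk s). split; [apply ord_rk |]. intros h. apply rk_mem in h.
  rewrite (rk_ord (ord_rk s)) in h. now apply mem_irrefl in h.
Qed.

(** If [x] were never listed, every listed set would have rank at most that of [x]; inverting the
    injective [enum] on a single V_b would then collect all ordinals into a set. *)
Lemma enum_onto x : exists a, ord a /\ enum a = x.
Proof.
  apply NNPP. intros hn.
  assert (hle : forall a, ord a -> enum a ∈ Vf (succ (rk x))).
  { intros a ha. apply in_Vf; [apply ord_succ, ord_rk |]. apply in_succ.
    destruct (ord_sub_cases (ord_rk (enum a)) (ord_rk x)); auto.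
    apply (proj2 (enum_spec a)). intros h. apply in_image in h as (u & hu & e).
    apply hn. exists u. split; auto. eapply ord_mem; eauto. }
  destruct (zf_replacement hV (F := fun u v => ord v /\ u = enum v)
    (x := Vf (succ (rk x)))) as (s & hs).
  - intros u v w _ [hv ->] [hw e]. now apply enum_inj.
  - destruct (no_set_of_ordinals s) as (a & ha & h). apply h, hs. eauto.
Qed.

Definition pos x : V := witness (enum_onto x).

Lemma ord_pos x : ord (pos x).
Proof. exact (proj1 (witness_spec (enum_onto x))). Qed.

Lemma enum_pos x : enum (pos x) = x.
Proof. exact (proj2 (witness_spec (enum_onto x))). Qed.

Lemma pos_enum a : ord a -> pos (enum a) = a.
Proof. intros h. apply enum_inj; auto using ord_pos, enum_pos. Qed.

Lemma pos_inj x y : pos x = pos y -> x = y.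
Proof. intros h. now rewrite <- (enum_pos x), h, enum_pos. Qed.

(** By induction the elements of a set x in V_d have positions below some h in k, so x is coded by a
    subset of h, and the bound for functions of subsets applies to the position of the decoded set.
    This treats only those x whose position is in k; that there are no others is shown last. *)
Lemma subtle_pos_bounded k (hk : is_subtle k) d :
  d ∈ k -> exists b, b ∈ k /\ forall x, rk x ∈ d -> pos x ∈ b.
Proof.
  destruct (subtle_limit hk) as (ok & hw & _).
  induction (mem_wf d) as [d _ IH]. intros hd.
  assert (od := ord_mem ok hd).
  destruct (choice_on (Q := fun e => e ∈ d)
    (S := fun e b => b ∈ k /\ forall x, rk x ∈ e -> pos x ∈ b) empty) as (g & hg).
  { intros e he. apply IH; auto. eapply ord_trans; eauto. }
  destruct (@subtle_bounded_on_ordinal k hk d g hd) as (h & hh & hgh).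
  { intros u hu. apply hg, hu. }
  assert (oh := ord_mem ok hh).
  assert (hpos : forall x y, rk x ∈ d -> y ∈ x -> pos y ∈ h).
  { intros x y hx hy. destruct (hg _ hx) as [hgx hb].
    eapply ord_trans; [| apply hgh |]; eauto using rk_mem. }
  (* [c] is decoded to [image enum c]; positions outside k, not yet excluded, are replaced by
     [omega]. *)
  pose (F := fun c => let p := pos (image enum c) in
    if excluded_middle_informative (p ∈ k) then p else omega).
  destruct (@subtle_bounded_on_subsets k hk h F hh) as (b & hb & hF).
  { intros c _. unfold F.
    destruct (excluded_middle_informative (pos (image enum c) ∈ k)); auto. }
  assert (key : forall x, rk x ∈ d -> pos x ∈ k -> pos x ∈ b).
  { intros x hx hxk.
    assert (e : image enum (image pos x) = x).
    { apply set_ext; intro z. rewrite in_image. split.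
      - intros (u & hu & ->). apply in_image in hu as (y & hy & ->).
        now rewrite enum_pos.
      - intros hz. exists (pos z). rewrite in_image, enum_pos. eauto. }
    assert (hsub : image pos x ⊆ h).
    { intros z hz. apply in_image in hz as (y & hy & ->). eauto. }
    specialize (hF _ hsub). unfold F in hF. rewrite e in hF.
    destruct (excluded_middle_informative (pos x ∈ k)); tauto. }
  exists b. split; auto. intros x hx. apply key; auto. apply NNPP. intros hn.
  (* Otherwise b < pos x, so enum b has rank at most that of x, and
     b = pos (enum b) would be below b. *)
  assert (hbx : b ∈ pos x).
  { apply ord_not_mem in hn; auto using ord_pos. }
  assert (ob := ord_mem ok hb).
  assert (hr := enum_rk_mono (ord_pos x) hbx). rewrite enum_pos in hr.
  assert (hbb : pos (enum b) ∈ b).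
  { apply key; [| now rewrite pos_enum].
    apply ord_sub_mem with (rk x); auto using ord_rk. }
  rewrite pos_enum in hbb; auto. now apply mem_irrefl in hbb.
Qed.

(** Positions replace the set [x] by an ordinal below k, on which functions are already known to be
    bounded. *)
Lemma subtle_inaccessible k : is_subtle k -> inaccessible k.
Proof.
  intros hk. assert (hl := subtle_limit hk). split; auto.
  destruct hl as (ok & hw & hsucc). intros x F hx hF.
  destruct (@subtle_pos_bounded k hk (rk x) hx) as (h & hh & hpos).
  destruct (@subtle_bounded_on_ordinal k hk h
    (fun e => if excluded_middle_informative (enum e ∈ x) then F (enum e) else omega))
    as (b & hb & hF'); auto.
  - intros u hu. destruct (excluded_middle_informative (enum u ∈ x)); auto.
  - exists b. split; auto. intros u hu. specialize (hF' _ (hpos u (rk_mem hu))).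
    rewrite enum_pos in hF'.
    destruct (excluded_middle_informative (u ∈ x)); tauto.
Qed.

Definition closed_under (G : V -> V) a := forall x, x ∈ a -> G x ∈ a.

Lemma inac_bounded_nat k (hk : inaccessible k) (F : nat -> V) :
  (forall n, F n ∈ k) -> exists b, b ∈ k /\ forall n, F n ∈ b.
Proof.
  intros hF. destruct (inac_limit hk) as (ok & hw & _).
  assert (hex : forall u, (exists n, u = num n) -> exists v, exists n, u = num n /\ v = F n)
    by (intros u (n & ->); eauto).
  destruct (choice_on empty hex) as (f & hf).
  destruct (inac_bounded hk (x := omega) (F := f)) as (b & hb & h).
  - now rewrite rk_ord by apply ord_omega.
  - intros u hu. apply in_omega, hf in hu as (n & -> & ->). auto.
  - exists b. split; auto. intros n.
    destruct (hf (num n)) as (m & e & h'); eauto.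
    apply num_inj in e; subst m. rewrite <- h'. apply h, num_in_omega.
Qed.

(** The supremum of omega many successive bounds; it stays below k because [omega ∈ k] and
    inaccessibility bound countable sequences. *)
Lemma closure_point k (hk : inaccessible k) (G : V -> V) c :
  closed_under G k -> c ∈ k ->
  exists d, d ∈ k /\ c ∈ d /\ limit_above_omega d /\ closed_under G d.
Proof.
  intros hG hc. destruct (inac_limit hk) as (ok & hw & hs).
  assert (hstep : forall a, a ∈ k -> exists b, b ∈ k /\
            a ∈ b /\ forall x, x ∈ a -> G x ∈ b).
  { intros a ha. destruct (inac_bounded hk (x := a) (F := G)) as (b & hb & h).
    - rewrite rk_ord; eauto using ord_mem.
    - intros u hu. apply hG. eapply ord_trans; eauto.
    - exists (succ (cup a b)).
      assert (hab : cup a b ∈ k) by (apply cup_in; auto).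
      assert (oab := ord_mem ok hab).
      split; auto. split.
      + apply ord_sub_mem with (cup a b); eauto using ord_mem, ord_succ.
        * intros z hz. apply in_cup; auto.
        * apply in_succ; auto.
      + intros x hx. apply in_succ. left. apply in_cup. auto. }
  destruct (choice_on empty hstep) as (s & hs').
  (* Starting above both [c] and [omega] puts them into the limit. *)
  pose (f := fix f n := match n with 0 => cup (succ c) (succ omega) | S n => s (f n) end).
  assert (hf : forall n, f n ∈ k).
  { induction n; simpl; [apply cup_in; auto | apply hs'; auto]. }
  assert (hS : forall n, f n ∈ f (S n)) by (intro n; apply hs'; auto).
  destruct (nat_image f) as (im & him).
  destruct (inac_bounded_nat hk hf) as (b & hb & hfb).
  assert (od : ord (union im)).
  { apply ord_union. intros y hy. apply him in hy as (n & ->).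
    eapply ord_mem; eauto. }
  assert (hin : forall n x, x ∈ f n -> x ∈ union im).
  { intros n x hx. apply in_union. exists (f n). split; auto. apply him; eauto. }
  assert (hget : forall x, x ∈ union im -> exists n, x ∈ f n).
  { intros x hx. apply in_union in hx as (y & hy & hx).
    apply him in hy as (n & ->). eauto. }
  exists (union im). split; [| split; [| split]].
  - apply ord_sub_mem with b; auto. intros x hx.
    apply hget in hx as (n & hx). eapply ord_trans; eauto using ord_mem.
  - apply (hin 0). simpl. rewrite in_cup, !in_succ. auto.
  - split; auto. split.
    + apply (hin 0). simpl. rewrite in_cup, !in_succ. auto.
    + intros x hx. apply hget in hx as (n & hx).
      assert (on : ord (f n)) by eauto using ord_mem.
      apply (hin (S n)).
      apply ord_sub_mem with (f n); eauto using ord_mem.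
      * now apply succ_sub.
      * eauto using ord_succ, ord_mem.
  - intros x hx. apply hget in hx as (n & hx). apply (hin (S n)).
    apply hs'; auto.
Qed.

(** * Coherent pairs and the subtle ideal *)

(** Agreement on V_a of a family of sets. The index set is a Rocq type, so that data of different
    kinds can be joined into one family. *)
Definition coherent (I : Type) (A : V -> I -> V -> Prop) a b : Prop :=
  forall i x, rk x ∈ a -> (A a i x <-> A b i x).

(** The union of two ordinals is their maximum, so closure under a single function can express
    closure under two. *)
Lemma closed_under_cup F G a :
  ord a -> (forall x, x ∈ a -> ord (F x)) -> (forall x, x ∈ a -> ord (G x)) ->
  closed_under (fun x => cup (F x) (G x)) a ->
  closed_under F a /\ closed_under G a.
Proof.
  intros oa hF hG h. split; intros x hx;
    apply ord_sub_mem with (cup (F x) (G x)); auto;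
    intros z hz; apply in_cup; auto.
Qed.

Lemma closed_under_cup_intro F G a :
  ord a -> closed_under F a -> closed_under G a ->
  closed_under (fun x => cup (F x) (G x)) a.
Proof. intros oa hF hG x hx. apply cup_in; auto. Qed.

Lemma rk_num n : rk (num n) = num n.
Proof. apply rk_ord, ord_num. Qed.

Lemma num_in_limit n a : limit_above_omega a -> num n ∈ a.
Proof. intros (oa & hw & _). eapply ord_trans; eauto using num_in_omega. Qed.

Lemma rk_empty : rk empty = empty.
Proof. exact (rk_num 0). Qed.

Lemma empty_in_limit a : limit_above_omega a -> empty ∈ a.
Proof. exact (@num_in_limit 0 a). Qed.

Definition pos_bound k (g : V -> V) : Prop :=
  closed_under g k /\ forall d, d ∈ k -> forall x, rk x ∈ d -> pos x ∈ g d.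

Lemma pos_bound_exists k : is_subtle k -> exists g, pos_bound k g.
Proof.
  intros hk.
  destruct (choice_on (Q := fun d => d ∈ k)
    (S := fun d b => b ∈ k /\ forall x, rk x ∈ d -> pos x ∈ b) empty) as (g & hg).
  - intros d hd. now apply subtle_pos_bounded.
  - exists g. split; intros d hd; apply hg; auto.
Qed.

(* The set {(i, x) : A a i x} is coded by a set of ordinals through pos; for a
   closed under the bound g this subset of V_a becomes a subset of a. *)
Lemma subtle_coherent k (hk : is_subtle k) (G : V -> V) (I : Type) (c : I -> nat)
    (A : V -> I -> V -> Prop) :
  closed_under G k -> (forall i j, c i = c j -> i = j) ->
  exists a b, b ∈ k /\ a ∈ b /\ limit_above_omega a /\ limit_above_omega b /\
    closed_under G a /\ closed_under G b /\ coherent A a b.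
Proof.
  intros hG hc. assert (ik := subtle_inaccessible hk).
  assert (ok := subtle_ord hk).
  destruct (pos_bound_exists hk) as (g & hgk & hg).
  destruct (@subtle_coherent_pair k hk
              (fun a => a ∈ k /\ limit_above_omega a /\ closed_under G a /\ closed_under g a)
              (fun a u => exists i x, u = pos (opair (num (c i)) x) /\ A a i x))
    as (a & b & hb & (hak & la & Ga & ga) & (_ & lb & Gb & gb) & hab & h).
  - intros x hx.
    destruct (closure_point ik (closed_under_cup_intro ok hG hgk) hx)
      as (d & hd & hxd & ld & hcl).
    apply closed_under_cup in hcl; [| apply ld | |].
    + exists d. tauto.
    + intros y hy. eapply ord_mem; [| apply hG]; eauto. eapply ord_trans; eauto.
    + intros y hy. eapply ord_mem; [| apply hgk]; eauto. eapply ord_trans; eauto.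
  - intros x hx (y0 & hy0) h. assert (ox := ord_mem ok hx).
    split; [auto |]. split; [split; [auto |]; split | split].
    + destruct (h y0 hy0) as (z & (_ & (_ & hw & _) & _) & hz & _).
      eapply ord_trans; eauto.
    + intros y hy. destruct (h y hy) as (z & (_ & (_ & _ & hs) & _) & hz & hyz).
      eapply ord_trans; eauto.
    + intros y hy. destruct (h y hy) as (z & (_ & _ & hs & _) & hz & hyz).
      eapply ord_trans; eauto.
    + intros y hy. destruct (h y hy) as (z & (_ & _ & _ & hs) & hz & hyz).
      eapply ord_trans; eauto.
  - exists a, b. repeat (split; [assumption |]). intros i x hx.
    pose (p := opair (num (c i)) x).
    assert (hp : rk p ∈ a).
    { apply rk_opair; auto; try apply la. rewrite rk_num. now apply num_in_limit. }
    assert (oa := proj1 la).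
    assert (hpa : pos p ∈ a).
    (* The bound [g] covers sets of rank strictly below its argument, hence the successor. *)
    { assert (hsp : succ (rk p) ∈ a) by (apply la; auto).
      eapply ord_trans; [auto | apply (ga _ hsp) |].
      apply hg; [eapply ord_trans; eauto | apply in_succ; auto]. }
    assert (hiff : forall a', (exists i' x', pos p = pos (opair (num (c i')) x') /\ A a' i' x')
              <-> A a' i x).
    { intro a'. split; [| unfold p; eauto].
      intros (i' & x' & e & hA). apply pos_inj, opair_inj in e as [e ->].
      apply num_inj, hc in e. now subst. }
    rewrite <- !hiff. now apply h.
Qed.

Section Small.
Variables (k : V) (hk : is_subtle k).

(* An ideal: k is subtle precisely because k itself is not small. *)
Definition small (X : V -> Prop) : Prop :=
  exists (I : Type) (c : I -> nat) (A : V -> I -> V -> Prop),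
    (forall i j, c i = c j -> i = j) /\
    forall a b, b ∈ k -> a ∈ b -> limit_above_omega a -> limit_above_omega b ->
      X a -> X b -> ~ coherent A a b.

(** Otherwise X contains all limits above omega that are closed under [G], and [subtle_coherent]
    finds two of them on which the data for X agree. *)
Lemma small_avoid X G : small X -> closed_under G k ->
  exists b, b ∈ k /\ limit_above_omega b /\ closed_under G b /\ ~ X b.
Proof.
  intros (I & c & A & hc & hX) hG. apply NNPP. intros hn.
  assert (hall : forall b, b ∈ k -> limit_above_omega b -> closed_under G b -> X b).
  { intros b hb hl hcl. apply NNPP. intros h. apply hn. eauto 6. }
  destruct (subtle_coherent hk A hG hc) as (a & b & hb & hab & la & lb & ga & gb & h).
  assert (hak : a ∈ k) by (eapply ord_trans; eauto using subtle_ord).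
  exact (hX a b hb hab la lb (hall a hak la ga) (hall b hb lb gb) h).
Qed.

(** The coordinate [None] records membership in X. Two coherent ordinals are then both in X or both
    outside it, hence in Y, and the data of that one set give the contradiction. *)
Lemma small_union X Y : small X -> small Y -> small (fun a => X a \/ Y a).
Proof.
  intros (I & c & A & hc & hX) (J & d & B & hd & hY).
  exists (option (I + J)),
    (fun i => match i with
       | None => nat_pair 0 0
       | Some (inl i) => nat_pair 1 (c i)
       | Some (inr j) => nat_pair 2 (d j)
     end),
    (fun a (i : option _) x => match i with
       | None => X a
       | Some (inl i) => A a i x
       | Some (inr j) => B a j x
     end).
  split.
  - intros [[i | i] |] [[j | j] |] h; apply nat_pair_inj in h as [h h'];
      try discriminate h; f_equal; f_equal; auto.
  - intros a b hb hab la lb ha hb' hco.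
    assert (hflag : X a <-> X b).
    { apply (hco None empty). rewrite rk_empty. now apply empty_in_limit. }
    destruct (classic (X a)) as [h | h].
    + apply (hX a b); try tauto. intros i x. apply (hco (Some (inl i)) x).
    + apply (hY a b); try tauto. intros i x. apply (hco (Some (inr i)) x).
Qed.

Definition regular a : Prop :=
  forall m (F : V -> V), m ∈ a -> (forall u, u ∈ m -> F u ∈ a) ->
    exists b, b ∈ a /\ forall u, u ∈ m -> F u ∈ b.

Lemma small_singular : small (fun a => ~ regular a).
Proof.
  destruct (choice_on (Q := fun a => ~ regular a)
    (S := fun a (w : V * (V -> V)) => fst w ∈ a /\
       (forall u, u ∈ fst w -> snd w u ∈ a) /\
       ~ exists b, b ∈ a /\ forall u, u ∈ fst w -> snd w u ∈ b)
    (empty, fun x => x)) as (w & hw).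
  { intros a h. apply NNPP. intros hn. apply h. intros m F hm hF.
    apply NNPP. intros h'. apply hn. exists (m, F). auto. }
  exists bool, (fun i : bool => if i then 1 else 0),
    (* [true] stores the domain as a single element of V_a, [false] stores the graph. *)
    (fun a (i : bool) x => if i then x = fst (w a)
       else exists u, u ∈ fst (w a) /\ x = opair u (snd (w a) u)).
  split; [intros [] []; simpl; congruence |].
  intros a b hb hab la lb ha hb' hco.
  destruct (hw a ha) as (hma & hFa & _). destruct (hw b hb') as (_ & _ & hub).
  assert (oa := proj1 la).
  assert (e : fst (w a) = fst (w b)).
  { apply (hco true). now rewrite rk_ord by eauto using ord_mem. reflexivity. }
  apply hub. exists a. split; auto. intros u hu. rewrite <- e in hu.
  assert (hua : u ∈ a) by (eapply ord_trans; eauto).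
  assert (h : exists u', u' ∈ fst (w b) /\
             opair u (snd (w a) u) = opair u' (snd (w b) u')).
  { apply (hco false); eauto. apply rk_opair; try apply la;
      rewrite rk_ord; eauto using ord_mem. }
  destruct h as (u' & _ & h). apply opair_inj in h as [<- <-]. auto.
Qed.

Variable T : V -> formula -> V -> Prop.

Lemma small_nonstationary :
  small (fun b => exists G, closed_under G b /\
    forall a, a ∈ b -> limit_above_omega a -> closed_under G a -> ~ coherent T a b).
Proof.
  match goal with |- small ?X => set (Y := X) end.
  destruct (choice_on (Q := Y) (S := fun b G => closed_under G b /\
    forall a, a ∈ b -> limit_above_omega a -> closed_under G a -> ~ coherent T a b)
    (fun x => x) (fun b h => h)) as (G & hG).
  exists (option formula),
    (fun i => match i with None => 0 | Some p => S (formula_code p) end),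
    (fun a (i : option _) x => match i with
       | None => exists u, u ∈ a /\ x = opair u (G a u)
       | Some p => T a p x
     end).
  split.
  { intros [p |] [q |] h; try discriminate; f_equal.
    apply formula_code_inj. now injection h. }
  intros a b hb hab la lb ha hb' hco.
  apply (proj2 (hG b hb') a); auto.
  (* [a] is closed under its own function [G a], and the coherent graphs make [G b] agree with it
     below [a]. *)
  - intros u hu.
    assert (oa := proj1 la). assert (hGu := proj1 (hG a ha) u hu).
    assert (h : exists u', u' ∈ b /\ opair u (G a u) = opair u' (G b u')).
    { apply (hco None); eauto. apply rk_opair; try apply la;
        rewrite rk_ord; eauto using ord_mem. }
    destruct h as (u' & _ & h). now apply opair_inj in h as [<- <-].
  - intros p x. apply (hco (Some p) x).
Qed.

Lemma small_describable :
  small (fun a => exists p B, B ⊆ a /\ T a p B /\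
    forall l, l ∈ a -> ~ T l p (sep (fun z => z ∈ l) B)).
Proof.
  match goal with |- small ?X => set (Y := X) end.
  destruct (choice_on (Q := Y) (S := fun a w => snd w ⊆ a /\ T a (fst w) (snd w) /\
    forall l, l ∈ a -> ~ T l (fst w) (sep (fun z => z ∈ l) (snd w))) (fBot, empty))
    as (w & hw).
  { intros a (p & B & h). now exists (p, B). }
  exists (option formula),
    (fun i => match i with None => 0 | Some p => S (formula_code p) end),
    (fun a (i : option _) x => match i with
       | None => x ∈ snd (w a)
       (* The formula is recorded by a condition that is constant in [x], so comparing one
          coordinate at [empty] already identifies it. *)
       | Some p => p = fst (w a)
     end).
  split.
  { intros [p |] [q |] h; try discriminate; f_equal.
    apply formula_code_inj. now injection h. }
  intros a b hb hab la lb ha hb' hco.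
  destruct (hw a ha) as (hsa & hTa & _). destruct (hw b hb') as (hsb & _ & hnb).
  assert (oa := proj1 la).
  assert (e : fst (w a) = fst (w b)).
  { apply (hco (Some (fst (w a))) empty); auto.
    rewrite rk_empty. now apply empty_in_limit. }
  apply (hnb a hab). rewrite <- e.
  replace (sep (fun z => z ∈ a) (snd (w b))) with (snd (w a)); auto.
  assert (hiff : forall z, z ∈ a -> (z ∈ snd (w a) <-> z ∈ snd (w b))).
  { intros z hz. apply (hco None). rewrite rk_ord; eauto using ord_mem. }
  apply set_ext; intro z. rewrite in_sep. split.
  - intros h. split; auto. apply hiff; auto.
  - intros [h1 h2]. now apply hiff.
Qed.

End Small.

(** * Reflection *)

Definition code_seq (e : nat -> V) : V :=
  witness (nat_image (fun n => opair (num n) (e n))).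

Lemma in_code_seq e z : z ∈ code_seq e <-> exists n, z = opair (num n) (e n).
Proof. exact (witness_spec (nat_image (fun n => opair (num n) (e n))) z). Qed.

Lemma code_seq_inj e e' : code_seq e = code_seq e' -> e = e'.
Proof.
  intros h. apply functional_extensionality. intros n.
  assert (hn : opair (num n) (e n) ∈ code_seq e') by (rewrite <- h, in_code_seq; eauto).
  apply in_code_seq in hn as (m & hm). apply opair_inj in hm as [e1 e2].
  apply num_inj in e1. now subst.
Qed.

Lemma rk_pset x : rk (pset x) ⊆ succ (rk x).
Proof.
  apply rk_sub; [apply ord_succ, ord_rk |]. intros y hy.
  apply in_pset in hy. apply rk_mono in hy. apply in_succ.
  destruct (ord_sub_cases (ord_rk y) (ord_rk x) hy); auto.
Qed.

Lemma rk_Vf a : ord a -> rk (Vf a) ⊆ a.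
Proof. intros oa. apply rk_sub; auto. intros y hy. now apply in_Vf. Qed.

Lemma Vf_mono a b : ord a -> ord b -> a ⊆ b -> Vf a ⊆ Vf b.
Proof. intros oa ob h x hx. apply in_Vf in hx; auto. apply in_Vf; auto. Qed.

(* A formula and its infinite assignment are coded together by one subset of
   V_d, so that a single use of inac_bounded bounds all witnesses. *)
Lemma skolem_bound k (hk : inaccessible k) (P : V -> Prop) a : a ∈ k ->
  exists b, b ∈ k /\ forall p e, (forall i, rk (e i) ∈ a) ->
    (exists x, x ∈ Vf k /\ sat (fun x => x ∈ Vf k) P p (scons x e)) ->
    exists x, rk x ∈ b /\ sat (fun x => x ∈ Vf k) P p (scons x e).
Proof.
  intros ha. destruct (inac_limit hk) as (ok & hw & hs).
  (* A limit [d] above [a]: the codes are then subsets of V_d, and its power set still has rank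
     below k. *)
  destruct (closure_point hk (G := fun x => x) (fun x h => h) ha)
    as (d & hd & had & ld & _).
  assert (od := proj1 ld).
  pose (Q := fun c => exists p e, (forall i, rk (e i) ∈ a) /\
               c = code_seq (scons (num (formula_code p)) e)).
  destruct (choice_on (Q := Q) (S := fun c v => v ∈ k /\ forall p e,
      c = code_seq (scons (num (formula_code p)) e) ->
      (exists x, x ∈ Vf k /\ sat (fun x => x ∈ Vf k) P p (scons x e)) ->
      exists x, rk x ∈ v /\ sat (fun x => x ∈ Vf k) P p (scons x e)) empty)
    as (F & hF).
  { intros c (p & e & he & hc).
    assert (huniq : forall q e', c = code_seq (scons (num (formula_code q)) e') ->
              q = p /\ e' = e).
    { intros q e' h. rewrite hc in h. apply code_seq_inj in h. split.
      - symmetry. apply formula_code_inj, num_inj. exact (f_equal (fun f => f 0) h).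
      - symmetry. exact (f_equal (fun f i => f (S i)) h). }
    destruct (classic (exists x, x ∈ Vf k /\ sat (fun x => x ∈ Vf k) P p (scons x e)))
      as [(x & hx & hsat) | hn].
    - exists (succ (rk x)). split; [apply hs, in_Vf; auto |].
      intros q e' h _. apply huniq in h as [-> ->]. exists x. rewrite in_succ. auto.
    - exists omega. split; auto. intros q e' h h'. apply huniq in h as [-> ->]. tauto. }
  destruct (inac_bounded hk (x := sep Q (pset (Vf d))) (F := F)) as (b & hb & hbF).
  - apply rk_subset_in with (pset (Vf d)); auto.
    + intros z hz. now apply in_sep in hz.
    + apply ord_sub_mem with (succ d); auto using ord_rk.
      intros z hz. apply rk_pset in hz. apply in_succ in hz. apply in_succ.
      destruct (ord_sub_cases (ord_rk (Vf d)) od (rk_Vf od)) as [e | h].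
      * rewrite <- e. auto.
      * destruct hz as [hz | ->]; auto. left. eapply ord_trans; eauto.
  - intros u hu. apply in_sep in hu as [_ hu]. apply hF, hu.
  - exists b. split; auto. intros p e he hx.
    pose (c := code_seq (scons (num (formula_code p)) e)).
    assert (hQ : Q c) by (exists p, e; auto).
    assert (hc : c ∈ sep Q (pset (Vf d))).
    { apply in_sep. split; auto. apply in_pset. intros z hz.
      apply in_code_seq in hz as (n & ->). apply in_Vf; auto.
      apply rk_opair; auto; [apply ld | rewrite rk_num; now apply num_in_limit |].
      destruct n as [| n]; simpl; [rewrite rk_num; now apply num_in_limit |].
      eapply ord_trans; eauto. }
    destruct (proj2 (hF c hQ) p e eq_refl hx) as (x & hxF & hsat).
    exists x. split; auto. eapply ord_trans; eauto using ord_mem.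
Qed.

(** The values of an infinite assignment may have ranks cofinal in d, but those of its first n
    variables do not. Including [empty] allows the remaining variables to be reset to it. *)
Lemma finite_bound d (e : nat -> V) n :
  limit_above_omega d -> (forall i, rk (e i) ∈ d) ->
  exists a, a ∈ d /\ rk empty ∈ a /\ forall i, i < n -> rk (e i) ∈ a.
Proof.
  intros ld he. assert (od := proj1 ld). induction n as [| n (a & ha & h0 & IH)].
  - exists omega. split; [apply ld |]. split; [| lia].
    rewrite rk_empty. apply (num_in_omega 0).
  - exists (cup a (succ (rk (e n)))). split; [| split].
    + apply cup_in; auto. apply ld; auto.
    + apply in_cup; auto.
    + intros i hi. apply in_cup. destruct (Nat.eq_dec i n) as [-> | ne].
      * right. apply in_succ; auto.
      * left. apply IH. lia.
Qed.

(** The Tarski-Vaught test, with one function bounding the witnesses for all formulas. It serves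
    twice: for V_l inside V_k, and inside V_l with [P] the predicate R, which gives A6. *)
Lemma reflection k (hk : inaccessible k) (P : V -> Prop) :
  exists G, closed_under G k /\
    forall d, d ∈ k -> limit_above_omega d -> closed_under G d ->
      forall p e, (forall i, e i ∈ Vf d) ->
        (sat (fun x => x ∈ Vf d) P p e <-> sat (fun x => x ∈ Vf k) P p e).
Proof.
  assert (ok := proj1 (inac_limit hk)).
  destruct (choice_on empty (skolem_bound hk P)) as (G & hG).
  exists G. split; [intros a ha; apply hG; auto |].
  intros d hd ld hGd. assert (od := proj1 ld).
  assert (hdk : Vf d ⊆ Vf k).
  { apply Vf_mono; auto. intros z hz. eapply ord_trans; eauto. }
  induction p; simpl; intros e he; try tauto.
  - rewrite IHp1, IHp2 by auto. tauto.
  - assert (he' : forall x, x ∈ Vf d -> forall i, scons x e i ∈ Vf d)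
      by (intros x hx [| i]; simpl; auto).
    split.
    + intros h. apply NNPP. intros hn.
      apply not_all_ex_not in hn as (x & hx). apply imply_to_and in hx as [hx hns].
      destruct (fv_below_exists p) as (n & hn).
      pose (e1 := fun i => if i <? n then e i else empty).
      assert (hag : forall y, sat (fun x => x ∈ Vf k) P p (scons y e1) <->
                 sat (fun x => x ∈ Vf k) P p (scons y e)).
      { intros y. apply (@sat_fv _ _ _ p n); auto. intros [| i] hi; simpl; auto.
        unfold e1. destruct (Nat.ltb_spec i n); auto; lia. }
      destruct (@finite_bound d e n ld) as (a & ha & h0 & hea).
      { intros i. now apply in_Vf. }
      assert (hak : a ∈ k) by (eapply ord_trans; eauto).
      (* Witnesses are sought for the negation of [p], with the assignment cut off after its
         relevant variables so that it lies in V_a for some a below d. *)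
      destruct (proj2 (hG a hak) (fImp p fBot) e1) as (y & hy & hsy).
      * intros i. unfold e1. destruct (Nat.ltb_spec i n); auto.
      * exists x. split; auto. simpl. rewrite hag. auto.
      * simpl in hsy. rewrite hag in hsy. apply hsy.
        assert (hyd : y ∈ Vf d).
        { apply in_Vf; auto. exact (ord_trans od (hGd a ha) hy). }
        apply IHp; auto.
    + intros h x hx. apply IHp; auto.
Qed.

(** Closure under [g] puts the positions of the elements of [x] below an ordinal in l, and
    regularity applies to that ordinal. *)
Lemma regular_inaccessible k g l :
  pos_bound k g -> ord k -> l ∈ k -> limit_above_omega l -> regular l ->
  closed_under g l -> inaccessible l.
Proof.
  intros [_ hg] ok hl ll hr hgl. split; auto. intros x F hx hF.
  destruct (hr (g (rk x)) (fun u => if excluded_middle_informative (enum u ∈ x)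
              then F (enum u) else omega)) as (b & hb & h).
  - apply hgl, hx.
  - intros u _. destruct (excluded_middle_informative (enum u ∈ x)); auto. apply ll.
  - exists b. split; auto. intros u hu.
    assert (hp : pos u ∈ g (rk x)).
    { apply hg; [eapply ord_trans; eauto | now apply rk_mem]. }
    specialize (h _ hp). rewrite enum_pos in h.
    destruct (excluded_middle_informative (u ∈ x)); tauto.
Qed.

(** * Absoluteness *)

(** The embedding is kept abstract so that each notion is computed once: [j] is the identity for
    statements about V, and the inclusion for V_k and V_l. *)
Section TransitiveEmbedding.
Variables (M : setStruct) (j : M -> V).
Hypothesis j_inj : forall x y : M, j x = j y -> x = y.
Hypothesis j_mem : forall x y : M, x ∈ y <-> j x ∈ j y.
Hypothesis j_trans : forall (x : M) u, u ∈ j x -> exists y : M, j y = u.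

Lemma emb_mem_elim u (x : M) : u ∈ j x -> exists y : M, j y = u /\ y ∈ x.
Proof.
  intros h. destruct (j_trans h) as (y & <-). exists y. now rewrite j_mem.
Qed.

Lemma emb_pair (p x y : M) : is_pair p x y <-> j p = upair (j x) (j y).
Proof.
  split.
  - intros h. apply set_ext; intro z. rewrite in_upair. split.
    + intros hz. apply emb_mem_elim in hz as (z' & <- & hz).
      apply h in hz as [-> | ->]; auto.
    + intros [-> | ->]; apply j_mem, h; auto.
  - intros h z. rewrite j_mem, h, in_upair. split.
    + intros [e | e]; apply j_inj in e; auto.
    + intros [-> | ->]; auto.
Qed.

Lemma emb_opair (p x y : M) : is_opair p x y <-> j p = opair (j x) (j y).
Proof.
  split.
  - intros (u & v & hu & hv & hp). apply emb_pair in hu, hv, hp.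
    rewrite hp, hu, hv. reflexivity.
  - intros h.
    destruct (@j_trans p (sing (j x))) as (u & hu).
    { rewrite h. apply in_upair. auto. }
    destruct (@j_trans p (upair (j x) (j y))) as (v & hv).
    { rewrite h. apply in_upair. auto. }
    exists u, v. rewrite !emb_pair, hu, hv. auto.
Qed.

Lemma emb_opair_range (p : M) u v : j p = opair u v ->
  exists x y : M, j x = u /\ j y = v.
Proof.
  intros h. destruct (@j_trans p (upair u v)) as (w & hw).
  { rewrite h. apply in_upair. auto. }
  destruct (@j_trans w u) as (x & hx); [rewrite hw; apply in_upair; auto |].
  destruct (@j_trans w v) as (y & hy); [rewrite hw; apply in_upair; auto |].
  eauto.
Qed.

Lemma emb_maps (f x y : M) : maps f x y <-> opair (j x) (j y) ∈ j f.
Proof.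
  split.
  - intros (p & hp & h). apply emb_opair in hp. rewrite <- hp. now apply j_mem.
  - intros h. apply emb_mem_elim in h as (p & hp & h). exists p.
    now rewrite emb_opair.
Qed.

Lemma emb_succ (y x : M) : is_succ y x <-> j y = succ (j x).
Proof.
  split.
  - intros h. apply set_ext; intro z. rewrite in_succ. split.
    + intros hz. apply emb_mem_elim in hz as (z' & <- & hz).
      apply h in hz as [hz | ->]; auto. left. now apply j_mem.
    + intros [hz | ->].
      * destruct (emb_mem_elim hz) as (z' & <- & hz'). apply j_mem, h; auto.
      * apply j_mem, h; auto.
  - intros h z. rewrite j_mem, h, in_succ, j_mem. split.
    + intros [hz | e]; auto.
    + intros [hz | ->]; auto.
Qed.

Lemma emb_subset (x y : M) : x ⊆ y <-> j x ⊆ j y.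
Proof.
  split.
  - intros h z hz. apply emb_mem_elim in hz as (z' & <- & hz). apply j_mem; auto.
  - intros h z hz. apply j_mem, h, j_mem, hz.
Qed.

Lemma emb_inter (y x a : M) :
  is_inter y x a <-> j y = sep (fun z => z ∈ j a) (j x).
Proof.
  split.
  - intros h. apply set_ext; intro z. rewrite in_sep. split.
    + intros hz. apply emb_mem_elim in hz as (z' & <- & hz).
      apply h in hz. split; apply j_mem; tauto.
    + intros [hx ha]. apply emb_mem_elim in hx as (z' & <- & hx).
      apply j_mem, h. split; auto. now apply j_mem.
  - intros h z. rewrite !j_mem, h, in_sep. tauto.
Qed.

Lemma emb_ordinal (a : M) : is_ordinal a <-> ord (j a).
Proof.
  split.
  - intros (ht & _ & htr & _). split.
    + intros u hu v hv. apply emb_mem_elim in hu as (x & <- & hx).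
      apply emb_mem_elim in hv as (y & <- & hy). apply j_mem. eapply ht; eauto.
    + intros u hu v hv w hw. apply emb_mem_elim in hu as (x & <- & hx).
      apply emb_mem_elim in hv as (y & <- & hy).
      apply emb_mem_elim in hw as (z & <- & hz).
      assert (hya : y ∈ a) by exact (ht x hx y hy).
      apply j_mem. exact (htr z y x (ht y hya z hz) hya hx hz hy).
  - intros ha. assert (hin : forall x : M, x ∈ a -> j x ∈ j a) by (intros x; apply j_mem).
    split; [| split; [| split; [| split]]].
    + intros x hx y hy. apply j_mem. eapply ord_trans; eauto. now apply j_mem.
    + intros x _ h. apply j_mem in h. now apply mem_irrefl in h.
    + intros x y z _ _ hz hxy hyz. apply j_mem.
      apply j_mem in hxy, hyz. apply (ord_trans (ord_mem ha (hin z hz)) hyz hxy).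
    + intros x y hx hy. rewrite !j_mem.
      destruct (ord_trichotomy (ord_mem ha (hin x hx)) (ord_mem ha (hin y hy)))
        as [h | [h | h]]; auto.
    + intros b hb (x0 & hx0).
      destruct (least_exists (P := fun u => u ∈ j b)) as (u & hu & hmin).
      { exists (j x0). now apply j_mem. }
      apply emb_mem_elim in hu as (x & <- & hx). exists x. split; auto.
      intros y hy. rewrite j_mem.
      destruct (ord_trichotomy (ord_mem ha (hin x (hb x hx)))
        (ord_mem ha (hin y (hb y hy)))) as [h | [h | h]]; auto.
      exfalso. apply (hmin _ h). now apply j_mem.
Qed.

(** A function of M on an element of [a] induces one in V, and the bound found there is an element
    of [j a], hence comes from M. *)
Lemma emb_regular (a : M) :
  limit_above_omega (j a) -> regular (j a) -> is_regular a.
Proof.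
  intros (oa & hw & hs) hr.
  assert (hbd : forall m f : M, m ∈ a -> is_fun_into f m a ->
            exists b : M, b ∈ a /\ forall x y : M, maps f x y -> y ∈ b).
  { intros m f hm [[hdom hfun] hinto].
    destruct (choice_on (Q := fun u => u ∈ j m)
      (S := fun u v => exists x y : M, j x = u /\ j y = v /\ maps f x y) empty)
      as (F & hF).
    { intros u hu. apply emb_mem_elim in hu as (x & <- & hx).
      destruct (hfun x hx) as (y & hy & _). eauto 6. }
    destruct (hr (j m) F) as (b & hb & hFb).
    - now apply j_mem.
    - intros u hu. destruct (hF u hu) as (x & y & _ & <- & hxy).
      apply j_mem. eapply hinto; eauto.
    - apply emb_mem_elim in hb as (b' & <- & hb). exists b'. split; auto.
      intros x y hxy.
      assert (hx : x ∈ m).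
      { destruct hxy as (p & hp & hpf).
        destruct (hdom p hpf) as (x' & y' & hp' & hx').
        apply emb_opair in hp, hp'. rewrite hp in hp'.
        apply opair_inj in hp' as [e _]. apply j_inj in e. now subst. }
      assert (hx' : j x ∈ j m) by now apply j_mem.
      destruct (hF _ hx') as (x1 & y1 & e1 & e2 & h1). apply j_inj in e1; subst x1.
      destruct (hfun x hx) as (y0 & _ & hu).
      assert (y = y1) by (rewrite <- (hu y hxy), <- (hu y1 h1); reflexivity).
      subst y1. apply j_mem. rewrite e2. auto. }
  split; [split |]; [now apply emb_ordinal | | split; [split; [| split] |]].
  (* The values of a bijection onto [a] would all lie in some [b] in [a]; as [b] is itself a value,
     [b ∈ b]. *)
  - intros m hm (f & hf & honto). destruct (hbd m f hm hf) as (b & hb & hfb).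
    destruct (honto b hb) as (x & hx & _). apply hfb in hx.
    apply j_mem in hx. now apply mem_irrefl in hx.
  - now apply emb_ordinal.
  - apply emb_mem_elim in hw as (x & _ & hx). eauto.
  - intros x hx. apply j_mem, hs, emb_mem_elim in hx as (y & e & hy).
    exists y. split; auto. apply j_mem. rewrite e. apply in_succ. auto.
  - exact hbd.
Qed.

(** The recursion inside M uses the subsets available in M; since V_(j a) lies in the range of [j],
    these are all the subsets that occur. *)
Lemma emb_is_V_unique (a v : M) : ord (j a) ->
  (forall z, z ∈ Vf (j a) -> exists x : M, j x = z) ->
  is_V a v -> j v = Vf (j a).
Proof.
  intros oa hrange (f & s & hs & [hdom hfun] & hrec & hav).
  apply emb_succ in hs.
  assert (key : forall u, u ∈ succ (j a) ->
            forall x y : M, j x = u -> maps f x y -> j y = Vf u).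
  { intros u. induction (mem_wf u) as [u _ IH]. intros hu x y <- hxy.
    assert (os := ord_succ oa).
    apply set_ext; intro z. rewrite in_Vf_unfold. split.
    - intros hz. apply emb_mem_elim in hz as (z' & <- & hz).
      apply (hrec x y hxy) in hz as (x' & y' & hx' & hm & hsub).
      apply j_mem in hx'. exists (j x'). split; auto.
      rewrite <- (IH (j x') hx' (ord_trans os hu hx') x' y' eq_refl hm).
      now apply emb_subset.
    - intros (b & hb & hzb).
      assert (hbs : b ∈ succ (j a)) by (eapply ord_trans; eauto).
      destruct (emb_mem_elim hb) as (x' & <- & hx').
      destruct (hrange z) as (z' & <-).
      { apply in_Vf_unfold. exists (j x'). split; auto.
        apply in_succ in hu as [hu | hu].
        - eapply ord_trans; eauto.
        - now rewrite <- hu. }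
      destruct (hfun x') as (y' & hy' & _).
      { apply j_mem. now rewrite hs. }
      apply j_mem. apply (hrec x y hxy). exists x', y'. repeat split; auto.
      apply emb_subset. now rewrite (IH (j x') hb hbs x' y' eq_refl hy'). }
  apply (key (j a)) with a; auto. apply in_succ; auto.
Qed.

Lemma emb_is_V_intro (a v f s : M) : ord (j a) ->
  j s = succ (j a) -> j f = graph Vf (succ (j a)) -> j v = Vf (j a) -> is_V a v.
Proof.
  intros oa hs hf hv.
  assert (hmaps : forall x y : M, maps f x y <-> j x ∈ succ (j a) /\ j y = Vf (j x)).
  { intros x y. rewrite emb_maps, hf, <- maps_iff. apply maps_graph. }
  assert (hval : forall u, u ∈ succ (j a) -> exists x y : M, j x = u /\ j y = Vf u).
  { intros u hu. assert (h : opair u (Vf u) ∈ j f).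
    { rewrite hf. apply in_image. eauto. }
    apply emb_mem_elim in h as (p & hp & _). exact (emb_opair_range hp). }
  exists f, s. split; [now apply emb_succ |]. split; [split | split].
  - intros p hp. apply j_mem in hp. rewrite hf in hp.
    apply in_image in hp as (u & hu & hp).
    destruct (hval u hu) as (x & y & hx & hy). exists x, y.
    rewrite emb_opair, j_mem, hs, hx, hy. auto.
  - intros x hx. apply j_mem in hx. rewrite hs in hx.
    destruct (hval (j x) hx) as (x' & y & _ & hy). exists y. split.
    + now apply hmaps.
    + intros y' hy'. apply hmaps in hy' as [_ hy']. apply j_inj. congruence.
  - intros x y hxy z. apply hmaps in hxy as [hx hy].
    rewrite j_mem, hy, in_Vf_unfold. split.
    + intros (b & hb & hz).
      assert (hbs : b ∈ succ (j a)) by (eapply ord_trans; eauto using ord_succ).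
      destruct (hval b hbs) as (x' & y' & <- & hy'). exists x', y'.
      rewrite j_mem, hmaps, emb_subset, hy'. auto.
    + intros (x' & y' & hx' & hm & hz). apply hmaps in hm as [_ hm].
      exists (j x'). rewrite <- j_mem. split; auto. rewrite <- hm.
      now apply emb_subset.
  - apply hmaps. rewrite in_succ. auto.
Qed.

End TransitiveEmbedding.

Lemma is_V_Vf a : ord a -> is_V a (Vf a).
Proof.
  intros oa.
  apply (@emb_is_V_intro V (fun x => x)) with (graph Vf (succ a)) (succ a);
    eauto; tauto.
Qed.

Lemma regular_is_regular a : limit_above_omega a -> regular a -> is_regular a.
Proof. apply (@emb_regular V (fun x => x)); eauto; tauto. Qed.

(** * V_k as a structure of its own, for k inaccessible *)

Section Rank.
Variables (k : V) (ik : inaccessible k).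
Notation K := (substructure (Vf k)).
Notation val := (@proj1_sig V (fun x => x ∈ Vf k)).

Lemma val_inj (x y : K) : val x = val y -> x = y.
Proof.
  destruct x as [x hx], y as [y hy]; simpl. intros <-. f_equal.
  apply proof_irrelevance.
Qed.

Lemma val_mem (x y : K) : x ∈ y <-> val x ∈ val y.
Proof. reflexivity. Qed.

Lemma inac_ord : ord k.
Proof. apply (inac_limit ik). Qed.

Lemma in_Vf_inac x : x ∈ Vf k <-> rk x ∈ k.
Proof. apply in_Vf, inac_ord. Qed.

Lemma val_rk (x : K) : rk (val x) ∈ k.
Proof. apply in_Vf_inac, proj2_sig. Qed.

Lemma val_onto x : rk x ∈ k -> exists y : K, val y = x.
Proof. intros h. apply in_Vf_inac in h. now exists (exist _ x h). Qed.

Lemma val_trans (x : K) u : u ∈ val x -> exists y : K, val y = u.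
Proof.
  intros h. apply val_onto. apply ord_trans with (rk (val x));
    auto using inac_ord, rk_mem, val_rk.
Qed.

Lemma set_sat_val p (e : nat -> K) e' : (forall i, e' i = val (e i)) ->
  (set_sat (Vf k) p e' <-> sat (fun _ => True) (@no_pred K) p e).
Proof.
  intros he. symmetry. apply (@sat_transport K V val); auto.
  - intros x _. apply proj2_sig.
  - intros y hy. now exists (exist _ y hy).
  - intros x y _ _. apply val_mem.
  - intros x y _ _. apply val_inj.
  - unfold no_pred. tauto.
Qed.

Lemma rk_Vf_in a : a ∈ k -> rk (Vf a) ∈ k.
Proof.
  intros ha. assert (oa := ord_mem inac_ord ha).
  apply ord_sub_mem with a; auto using inac_ord, ord_rk, rk_Vf.
Qed.

Lemma rk_image (F : V -> V) x :
  rk x ∈ k -> (forall u, u ∈ x -> rk (F u) ∈ k) -> rk (image F x) ∈ k.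
Proof.
  intros hx hF. destruct (inac_bounded ik hx hF) as (b & hb & h).
  apply ord_sub_mem with b; auto using inac_ord, ord_rk.
  apply rk_sub; eauto using ord_mem, inac_ord.
  intros y hy. apply in_image in hy as (u & hu & ->). auto.
Qed.

(** V_k computes its own hierarchy correctly: it contains every element of V_a, and by
    inaccessibility also the graph of the recursion up to a. *)
Lemma val_is_V (a v : K) : ord (val a) -> (is_V a v <-> val v = Vf (val a)).
Proof.
  intros oa. assert (ha := val_rk a). rewrite rk_ord in ha by auto.
  destruct (inac_limit ik) as (ok & hw & hs).
  split.
  - apply (emb_is_V_unique val_inj val_mem val_trans); auto.
    intros z hz. apply val_onto. apply in_Vf in hz; auto. exact (ord_trans ok ha hz).
  - destruct (val_onto (x := succ (val a))) as (s & hs').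
    { rewrite rk_ord; auto using ord_succ. }
    destruct (val_onto (x := graph Vf (succ (val a)))) as (f & hf).
    { apply rk_image; [rewrite rk_ord; auto using ord_succ |].
      intros u hu.
      assert (hu' : u ∈ k) by exact (ord_trans ok (hs _ ha) hu).
      apply rk_opair; auto using rk_Vf_in. rewrite rk_ord; eauto using ord_mem. }
    intros hv. exact (emb_is_V_intro val_inj val_mem val_trans oa hs' hf hv).
Qed.

Lemma val_sat_in (v : K) p (e : nat -> K) e' (R : K -> Prop) (R' : V -> Prop) :
  (forall x : K, R x <-> R' (val x)) ->
  (forall i, e i ∈ v) -> (forall i, e' i = val (e i)) ->
  (sat (fun x : K => x ∈ v) R p e <-> sat (fun x => x ∈ val v) R' p e').
Proof.
  intros hR he he'. apply (@sat_transport K V val); auto.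
  - intros y hy. destruct (val_trans hy) as (x & <-).
    exists x. split; [exact hy | reflexivity].
  - intros x y _ _. apply val_mem.
  - intros x y _ _. apply val_inj.
Qed.

Lemma val_V_sat2 (b x s : K) p : ord (val b) ->
  rk (val x) ∈ val b -> rk (val s) ∈ val b ->
  (V_sat2 b p x s <-> set_sat (Vf (val b)) p (scons (val x) (fun _ => val s))).
Proof.
  intros ob hx hs. unfold V_sat2.
  assert (hv : forall v : K, val v = Vf (val b) ->
    (set_sat v p (scons x (fun _ => s)) <->
     set_sat (Vf (val b)) p (scons (val x) (fun _ => val s)))).
  { intros v hv. rewrite <- hv. apply val_sat_in.
    - unfold no_pred. tauto.
    - intros [| i]; simpl; rewrite hv; apply in_Vf; auto.
    - now intros [| i]. }
  split.
  - intros (v & hvV & h). apply val_is_V in hvV; auto. now apply (hv v).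
  - intros h. destruct (val_onto (x := Vf (val b))) as (v & e).
    { apply rk_Vf_in. rewrite <- (rk_ord ob). apply val_rk. }
    exists v. rewrite val_is_V, hv by auto. auto.
Qed.

End Rank.

(** * The model *)

(** The set T(a). The first conjunct makes all other formulas contribute nothing, so that coherence
    may range over the whole type [formula]. *)
Definition truth k a (p : formula) s : Prop :=
  set_formula2 p /\ set_sat (Vf k) p (scons a (fun _ => s)).

Record reflecting k l : Prop := {
  refl_mem : l ∈ k;
  refl_inac : inaccessible l;
  refl_reg : regular l;
  refl_elem : forall p e, (forall i, e i ∈ Vf l) ->
    (set_sat (Vf l) p e <-> set_sat (Vf k) p e);
  refl_stat : forall G, closed_under G l ->
    exists a, a ∈ l /\ limit_above_omega a /\ closed_under G a /\
      coherent (truth k) a l;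
  refl_indesc : forall p B, B ⊆ l -> truth k l p B ->
    exists x, x ∈ l /\ truth k x p (sep (fun z => z ∈ x) B)
}.

(** Closure under [G] makes V_l elementary in V_k, and closure under [g] turns regularity of l into
    inaccessibility. The three defects are avoided together as one small union. *)
Lemma reflecting_exists k : is_subtle k -> exists l, reflecting k l.
Proof.
  intros hk. assert (ik := subtle_inaccessible hk).
  assert (ok := subtle_ord hk).
  destruct (pos_bound_exists hk) as (g & hg).
  destruct (reflection ik (@no_pred V)) as (G & hGk & hG).
  destruct (small_avoid hk (G := fun x => cup (G x) (g x))
    (small_union (small_singular k)
      (small_union (small_nonstationary k (truth k)) (small_describable k (truth k)))))
    as (l & hl & ll & hcl & hX).
  { apply closed_under_cup_intro; auto. apply hg. }
  apply closed_under_cup in hcl as [hGl hgl]; [| apply ll | |].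
  - apply not_or_and in hX as [hr hX]. apply not_or_and in hX as [hst hin].
    apply NNPP in hr. exists l. split; auto.
    + eapply regular_inaccessible; eauto.
    + intros p e he. now apply hG.
    + intros F hF. apply NNPP. intros hn. apply hst. exists F. split; auto.
      intros a ha la haF hco. apply hn. eauto.
    + intros p B hB hT. apply NNPP. intros hn. apply hin. exists p, B.
      split; auto. split; auto. intros x hx hTx. apply hn. eauto.
  - intros x hx. eapply ord_mem; [| apply hGk]; eauto. eapply ord_trans; eauto.
  - intros x hx. eapply ord_mem; [| apply hg]; eauto. eapply ord_trans; eauto.
Qed.

Section Model.
Variables (k l : V) (ik : inaccessible k) (hl : reflecting k l).
Notation K := (substructure (Vf k)).
Notation L := (substructure (Vf l)).
Notation il := (refl_inac hl).

(** As V_0 is empty, 0 is vacuously coherent with l; it is excluded since it is not regular. *)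
Definition reflective a : Prop := (exists x, x ∈ a) /\ coherent (truth k) a l.

Lemma model_ord a : a ∈ l -> ord a.
Proof. apply ord_mem, inac_ord, il. Qed.

Lemma rk_l_k x : rk x ∈ l -> rk x ∈ k.
Proof. intros h. exact (ord_trans (inac_ord ik) (refl_mem hl) h). Qed.

Lemma reflective_transfer P : definable P ->
  forall a s (xa xl xs : K), reflective a -> a ∈ l -> rk s ∈ a ->
    proj1_sig xa = a -> proj1_sig xl = l -> proj1_sig xs = s ->
    (P K (scons xa (fun _ => xs)) <-> P K (scons xl (fun _ => xs))).
Proof.
  intros hP a s xa xl xs [_ hco] ha hs <- <- <-.
  destruct (definable_formula2 hP) as (p & hp & hpP).
  specialize (hco p _ hs). unfold truth in hco.
  assert (h : forall x : K, set_sat (Vf k) p (scons (proj1_sig x) (fun _ => proj1_sig xs))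
             <-> P K (scons x (fun _ => xs))).
  { intros x. rewrite <- hpP. apply set_sat_val. now intros [| i]. }
  rewrite !h in hco. tauto.
Qed.

Lemma elementary_transfer P : definable P ->
  forall (e : nat -> L) (e' : nat -> K),
    (forall i, proj1_sig (e i) = proj1_sig (e' i)) -> (P L e <-> P K e').
Proof.
  intros (p & _ & hp) e e' he. rewrite <- !hp.
  rewrite <- (@set_sat_val l p e (fun i => proj1_sig (e i))) by auto.
  rewrite <- (@set_sat_val k p e' (fun i => proj1_sig (e i))) by auto.
  apply (refl_elem hl). intros i. apply proj2_sig.
Qed.

(** Since l is not an element of V_l, the argument passes through V_k: there l is regular, coherence
    hands this to a, and elementarity brings it down to V_l. *)
Lemma reflective_regular (a : L) :
  reflective (proj1_sig a) -> proj1_sig a ∈ l -> is_regular a.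
Proof.
  intros ha hal. assert (oa := model_ord hal).
  destruct (val_onto ik (x := proj1_sig a)) as (xa & hxa).
  { apply rk_l_k. now rewrite rk_ord. }
  destruct (val_onto ik (x := l)) as (xl & hxl).
  { rewrite rk_ord; [apply (refl_mem hl) | apply inac_ord, il]. }
  (* Regularity has no parameter; any element of [a] fills the slot. *)
  destruct (proj1 ha) as (s & hs).
  assert (hsl : s ∈ l) by exact (ord_trans (inac_ord il) hal hs).
  destruct (val_onto ik (x := s)) as (xs & hxs).
  { apply rk_l_k. rewrite rk_ord; eauto using model_ord. }
  apply (elementary_transfer definable_is_regular (e := fun _ => a) (e' := fun _ => xa));
    [easy |].
  apply (reflective_transfer definable_is_regular (a := proj1_sig a) (s := s)
           (xa := xa) (xl := xl) (xs := xs)); auto.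
  - rewrite rk_ord; eauto using model_ord.
  - simpl. apply (emb_regular (@val_inj k) (@val_mem k) (val_trans ik)).
    + rewrite hxl. apply (inac_limit il).
    + rewrite hxl. apply (refl_reg hl).
Qed.

Lemma reflective_succ a : reflective a -> a ∈ l -> forall x, x ∈ a -> succ x ∈ a.
Proof.
  intros ha hal x hx. assert (oa := model_ord hal).
  destruct (val_onto il (x := a)) as (a' & <-); [now rewrite rk_ord |].
  destruct (reflective_regular ha hal) as (_ & (_ & _ & h) & _).
  destruct (val_trans il hx) as (x' & <-).
  destruct (h x' hx) as (y & hy & hxy).
  apply ord_sub_mem with (proj1_sig y); auto.
  - apply succ_sub; eauto using ord_mem.
  - eauto using ord_succ, ord_mem.
Qed.

Lemma pair_in_V_eval p a x s (xa t : K) :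
  ord a -> a ∈ k -> x ∈ Vf a -> s ∈ Vf a ->
  proj1_sig xa = a -> proj1_sig t = opair x s ->
  ((exists v : K, is_V xa v /\ exists y u : K, is_opair t y u /\ y ∈ v /\ u ∈ v /\
      sat (fun z : K => z ∈ v) (@no_pred K) p (scons y (fun _ => u))) <->
   set_sat (Vf a) p (scons x (fun _ => s))).
Proof.
  intros oa ha hx hs <- ht.
  assert (hsat : forall v y u : K, proj1_sig v = Vf (proj1_sig xa) ->
    proj1_sig y = x -> proj1_sig u = s ->
    (sat (fun z : K => z ∈ v) (@no_pred K) p (scons y (fun _ => u)) <->
     set_sat (Vf (proj1_sig xa)) p (scons x (fun _ => s)))).
  { intros v y u hv <- <-. rewrite <- hv. apply (val_sat_in ik).
    - unfold no_pred. tauto.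
    - intros [| i]; simpl; now rewrite hv.
    - now intros [| i]. }
  assert (hopair : forall y u : K, is_opair t y u <->
            proj1_sig t = opair (proj1_sig y) (proj1_sig u)).
  { intros y u. exact (emb_opair (@val_inj k) (@val_mem k) (val_trans ik) t y u). }
  split.
  - intros (v & hvV & y & u & hyu & _ & _ & h).
    apply (val_is_V ik) in hvV; auto. apply hopair in hyu. rewrite ht in hyu.
    apply opair_inj in hyu as [e1 e2]. apply (hsat v y u); auto.
  - intros h.
    destruct (val_onto ik (x := Vf (proj1_sig xa))) as (v & hv).
    { now apply rk_Vf_in. }
    destruct (emb_opair_range (val_trans ik) ht) as (y & u & hy & hu).
    exists v. split; [now apply (val_is_V ik) |]. exists y, u.
    split; [apply hopair; congruence |].
    split; [rewrite val_mem, hv, hy; auto |].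
    split; [rewrite val_mem, hv, hu; auto |].
    now apply (hsat v y u).
Qed.

(* Two parameters from V_a are coded as one ordered pair; evaluated at l, the
   formula asserts truth in V_l, which is an elementary substructure of V_k. *)
Lemma reflective_elementary a p x s : reflective a -> a ∈ l -> set_formula2 p ->
  rk x ∈ a -> rk s ∈ a ->
  (set_sat (Vf a) p (scons x (fun _ => s)) <->
   set_sat (Vf k) p (scons x (fun _ => s))).
Proof.
  intros ha hal [hp _] hx hs.
  assert (oa := model_ord hal). assert (ol := inac_ord il).
  assert (hpair : rk (opair x s) ∈ a).
  { apply rk_opair; auto. now apply reflective_succ. }
  assert (hak : a ∈ k) by exact (ord_trans (inac_ord ik) (refl_mem hl) hal).
  destruct (val_onto ik (x := a)) as (xa & hxa); [now rewrite rk_ord |].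
  destruct (val_onto ik (x := l)) as (xl & hxl).
  { rewrite rk_ord; auto. apply (refl_mem hl). }
  destruct (val_onto ik (x := opair x s)) as (t & ht).
  { exact (ord_trans (inac_ord ik) hak hpair). }
  rewrite <- (@pair_in_V_eval p a x s xa t); auto; try now apply in_Vf.
  assert (hxl' : rk x ∈ l) by exact (ord_trans ol hal hx).
  assert (hsl' : rk s ∈ l) by exact (ord_trans ol hal hs).
  rewrite <- (refl_elem hl).
  - rewrite <- (@pair_in_V_eval p l x s xl t); auto; try now apply in_Vf.
    + exact (reflective_transfer (definable_pair_in_V hp) ha hal hpair hxa hxl ht).
    + apply (refl_mem hl).
  - intros [| i]; simpl; now apply in_Vf.
Qed.

(** The right side no longer mentions [b]: truth in the various V_b of A3 and A8 becomes truth in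
    V_k, which is what T records. *)
Lemma model_V_sat2 (b x s : L) p : reflective (proj1_sig b) -> proj1_sig b ∈ l ->
  set_formula2 p -> rk (proj1_sig x) ∈ proj1_sig b -> rk (proj1_sig s) ∈ proj1_sig b ->
  (V_sat2 b p x s <-> set_sat (Vf k) p (scons (proj1_sig x) (fun _ => proj1_sig s))).
Proof.
  intros hb hbl hp hx hs.
  rewrite (val_V_sat2 il) by eauto using model_ord.
  now apply reflective_elementary.
Qed.

(** * Verification of A1-A8 in (V_l, ∈, R) *)

Definition reflective_set : V := sep reflective l.
Notation R := (@restrict_pred V (Vf l) reflective_set).

Lemma restrict_iff (a : L) : R a <-> proj1_sig a ∈ l /\ reflective (proj1_sig a).
Proof. apply in_sep. Qed.

Lemma model_comprehension (P : V -> Prop) (x : L) :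
  exists y : L, forall z : L, z ∈ y <-> z ∈ x /\ P (proj1_sig z).
Proof.
  destruct (val_onto il (x := sep P (proj1_sig x))) as (y & hy).
  - apply rk_subset_in with (proj1_sig x);
      [exact (inac_ord il) | | apply (val_rk il)].
    intros z hz. now apply in_sep in hz.
  - exists y. intro z. rewrite val_mem, hy. apply in_sep.
Qed.

(** As l is inaccessible in V, replacement holds in V_l for arbitrary relations; A5 is the case of
    relations given by R-formulas. *)
Lemma model_replacement (F : L -> L -> Prop) (x : L) :
  (forall u v w : L, u ∈ x -> F u v -> F u w -> v = w) ->
  exists y : L, forall v : L, v ∈ y <-> exists u : L, u ∈ x /\ F u v.
Proof.
  intros hF.
  pose (Q := fun u => exists u' v' : L, proj1_sig u' = u /\ F u' v').
  destruct (choice_on (Q := Q) (S := fun u v => exists u' v' : L,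
    proj1_sig u' = u /\ proj1_sig v' = v /\ F u' v') empty) as (f & hf).
  { intros u (u' & v' & hu & h). eauto 6. }
  assert (hsep : sep Q (proj1_sig x) ⊆ proj1_sig x)
    by (intros z hz; now apply in_sep in hz).
  destruct (val_onto il (x := image f (sep Q (proj1_sig x)))) as (y & hy).
  - apply (rk_image il).
    + apply rk_subset_in with (proj1_sig x); auto;
        [exact (inac_ord il) | apply (val_rk il)].
    + intros u hu. apply in_sep in hu as [_ hu].
      destruct (hf u hu) as (_ & v & _ & <- & _). apply (val_rk il).
  - exists y. intro v. rewrite val_mem, hy, in_image. split.
    + intros (u & hu & hv). apply in_sep in hu as [hux hu].
      destruct (hf u hu) as (u' & v' & <- & e & h). exists u'. split; auto.
      rewrite <- e in hv. apply (@val_inj l) in hv. now subst.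
    + intros (u & hu & h). exists (proj1_sig u).
      assert (hQ : Q (proj1_sig u)) by (exists u, v; auto).
      rewrite in_sep. split; [split; auto |].
      destruct (hf _ hQ) as (u' & v' & e & <- & h'). apply (@val_inj l) in e.
      subst u'. f_equal. eauto.
Qed.

(** By [model_V_sat2] the right side says that T(a) and T(b) agree on V_a. Since T(b) agrees with
    T(l) on V_b, which contains V_a, this is coherence of a with l. *)
Lemma model_indiscernible (a b c : L) : is_ordinal a -> R b -> R c ->
  (exists x : L, x ∈ a) -> a ∈ b -> b ∈ c ->
  (R a <-> forall p, set_formula2 p -> forall s : L, in_V a s ->
     (V_sat2 b p a s <-> V_sat2 c p b s)).
Proof.
  intros oa hb hc (x0 & hx0) hab hbc.
  apply restrict_iff in hb as [hbl hb], hc as [hcl hc].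
  assert (ob := model_ord hbl). assert (oc := model_ord hcl).
  assert (hal : proj1_sig a ∈ l) by exact (ord_trans (inac_ord il) hbl hab).
  assert (oa' := model_ord hal).
  assert (hin : forall s : L, in_V a s <-> rk (proj1_sig s) ∈ proj1_sig a).
  { intros s. unfold in_V. rewrite <- (in_Vf _ oa'). split.
    - intros (v & hvV & hs). apply (val_is_V il) in hvV; auto.
      now rewrite <- hvV.
    - intros hs. destruct (val_onto il (x := Vf (proj1_sig a))) as (v & hv).
      { now apply rk_Vf_in; [apply il |]. }
      exists v. split; [now apply (val_is_V il) |]. now rewrite val_mem, hv. }
  assert (hiff : forall p (s : L), set_formula2 p -> rk (proj1_sig s) ∈ proj1_sig a ->
    ((V_sat2 b p a s <-> V_sat2 c p b s) <->
     (truth k (proj1_sig a) p (proj1_sig s) <-> truth k l p (proj1_sig s)))).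
  { intros p s hp hs.
    assert (hsb := ord_trans ob hab hs). assert (hsc := ord_trans oc hbc hsb).
    rewrite (@model_V_sat2 b a s), (@model_V_sat2 c b s); auto;
      [| now rewrite rk_ord | now rewrite rk_ord].
    destruct hb as [_ hb]. specialize (hb p _ hsb). unfold truth in *. tauto. }
  rewrite restrict_iff. split.
  - intros [_ [_ hco]] p hp s hs. apply hin in hs. apply hiff; auto.
  - intros h. split; auto. split; [exists (proj1_sig x0); exact hx0 |].
    intros p s hs.
    (* For any other formula [truth] is false on both sides. *)
    destruct (classic (set_formula2 p)) as [hp | hp]; [| unfold truth; tauto].
    destruct (val_onto il (x := s)) as (s' & <-).
    { exact (ord_trans (inac_ord il) hal hs). }
    apply hiff; auto. apply h; auto. now apply hin.
Qed.

(** A point closed under the constant function with value rk x lies above rk x, so R has an element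
    whose rank is too large for membership in x. *)
Lemma model_unbounded : ~ exists x : L, forall a : L, a ∈ x <-> R a.
Proof.
  intros (x & hx).
  destruct (refl_stat hl (G := fun _ => rk (proj1_sig x))) as (a & hal & la & hcl & hco).
  { intros u _. apply (val_rk il). }
  assert (oa := proj1 la).
  assert (hw : omega ∈ a) by apply la.
  destruct (val_onto il (x := a)) as (a' & e); [now rewrite rk_ord |].
  assert (hR : R a').
  { apply restrict_iff. rewrite e. split; auto. split; eauto. }
  apply hx in hR. apply val_mem, rk_mem in hR. rewrite e, (rk_ord oa) in hR.
  specialize (hcl _ hw). apply (mem_irrefl (x := a)).
  exact (ord_trans oa hcl hR).
Qed.

(** (V_l, ∈, R) is reflected by every limit above omega closed under a certain function on l, and by
    [refl_stat] one of these limits is in R. *)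
Lemma model_reflection p : fv_below 1 p ->
  exists a : L, R a /\ forall s : L, in_V a s ->
    (sat (fun _ => True) R p (fun _ => s) <-> V_satR1 R a p s).
Proof.
  intros _.
  pose (P := fun x => x ∈ reflective_set).
  destruct (reflection il P) as (G & hGl & hG).
  destruct (refl_stat hl hGl) as (a & hal & la & hcl & hco).
  assert (oa := proj1 la).
  assert (hw : omega ∈ a) by apply la.
  destruct (val_onto il (x := a)) as (a' & e); [now rewrite rk_ord |].
  exists a'. split.
  { apply restrict_iff. rewrite e. split; auto. split; eauto. }
  assert (key : forall v s : L, is_V a' v -> s ∈ v ->
    (sat (fun _ => True) R p (fun _ => s) <->
     sat (fun x : L => x ∈ v) (fun x : L => R x /\ x ∈ v) p (fun _ => s))).
  { intros v s hvV hs. apply (val_is_V il) in hvV; [| now rewrite e].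
    rewrite e in hvV.
    transitivity (sat (fun x => x ∈ Vf a) P p (fun _ => proj1_sig s)).
    - rewrite hG; auto.
      + apply (@sat_transport L V (@proj1_sig _ _)); auto.
        * intros x _. apply proj2_sig.
        * intros y hy. now exists (exist _ y hy).
        * intros x y _ _. apply val_mem.
        * intros x y _ _. apply val_inj.
        * intros x _. reflexivity.
      + intros _. rewrite <- hvV. exact hs.
    - symmetry. apply (@sat_transport L V (@proj1_sig _ _)); auto.
      + intros x hx. rewrite <- hvV. exact hx.
      + intros y hy. destruct (val_onto il (x := y)) as (y' & <-).
        { apply in_Vf in hy; auto. exact (ord_trans (inac_ord il) hal hy). }
        exists y'. split; auto. now rewrite val_mem, hvV.
      + intros x y _ _. apply val_mem.
      + intros x y _ _. apply val_inj.
      + intros x hx. unfold P, restrict_pred. tauto. }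
  intros s (v0 & hv0 & hs). split.
  - intros h. exists v0. split; auto. now apply (key v0 s hv0 hs).
  - intros (v & hvV & h).
    assert (v = v0).
    { apply (val_is_V il) in hvV, hv0; try now rewrite e.
      apply (@val_inj l). congruence. }
    subst v. now apply (key v0 s hv0 hs).
Qed.

(** Everything involved has rank below b, so V_b may be replaced by V_k. If A described a there,
    coherence would give some set, possibly unrelated to A, that describes l, against
    [refl_indesc]. *)
Lemma model_indescribable (a b : L) : R a -> R b -> a ∈ b ->
  forall p, set_formula2 p -> forall A : L, A ⊆ a -> V_sat2 b p a A ->
    exists x B : L, x ∈ a /\ is_inter B A x /\ V_sat2 b p x B.
Proof.
  intros ha hb hab p hp A hA hsat.
  apply restrict_iff in ha as [hal ha], hb as [hbl hb].
  assert (ol := inac_ord il). assert (ok := inac_ord ik).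
  assert (oa := model_ord hal). assert (ob := model_ord hbl).
  assert (hemb : forall y x c : K, is_inter y x c <->
    proj1_sig y = sep (fun z => z ∈ proj1_sig c) (proj1_sig x)).
  { exact (emb_inter (@val_mem k) (val_trans ik)). }
  assert (hembL : forall y x c : L, is_inter y x c <->
    proj1_sig y = sep (fun z => z ∈ proj1_sig c) (proj1_sig x)).
  { exact (emb_inter (@val_mem l) (val_trans il)). }
  assert (hAa : proj1_sig A ⊆ proj1_sig a).
  { apply (emb_subset (@val_mem l) (val_trans il)). exact hA. }
  assert (hsubrk : forall B, B ⊆ proj1_sig a -> rk B ∈ proj1_sig b).
  { intros B hB. apply rk_subset_in with (proj1_sig a); auto.
    now rewrite rk_ord. }
  assert (hrkb : forall x, rk x ∈ proj1_sig b -> rk x ∈ l)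
    by (intros x hx; exact (ord_trans ol hbl hx)).
  apply model_V_sat2 in hsat; auto; [| now rewrite rk_ord].
  assert (hsatK : forall x s : K, set_sat (Vf k) p (scons (proj1_sig x) (fun _ => proj1_sig s))
    <-> sat (fun _ => True) (@no_pred K) p (scons x (fun _ => s))).
  { intros x s. apply set_sat_val. now intros [| i]. }
  destruct (val_onto ik (x := proj1_sig a)) as (xa & hxa).
  { rewrite rk_ord; auto. exact (ord_trans ok (refl_mem hl) hal). }
  destruct (val_onto ik (x := l)) as (xl & hxl).
  { rewrite rk_ord; auto. apply (refl_mem hl). }
  destruct (val_onto ik (x := proj1_sig A)) as (xA & hxA).
  { apply rk_l_k, hrkb, hsubrk, hAa. }
  (* A dummy parameter: describability speaks of the ordinal alone. *)
  destruct (val_onto ik (x := empty)) as (x0 & hx0).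
  { rewrite rk_empty. apply empty_in_limit, (inac_limit ik). }
  assert (h0 : rk empty ∈ proj1_sig a).
  { destruct (proj1 ha) as (z & hz). apply ord_sub_mem with z; auto using ord_rk.
    rewrite rk_empty. intros w hw. now apply not_in_empty in hw. }
  assert (htr := reflective_transfer (definable_describable (proj1 hp)) ha hal h0
                   hxa hxl hx0).
  simpl in htr.
  apply NNPP. intros hn. destruct (proj1 htr) as (B & hB & hBs & hBn).
  - exists xA. split; [| split].
    + apply (emb_subset (@val_mem k) (val_trans ik)). now rewrite hxa, hxA.
    + apply hsatK. now rewrite hxa, hxA.
    + intros x B hx hxB hs. apply hn.
      assert (hxa' : proj1_sig x ∈ proj1_sig a) by (rewrite <- hxa; exact hx).
      apply hemb in hxB. rewrite hxA in hxB.
      assert (hBa : proj1_sig B ⊆ proj1_sig a).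
      { rewrite hxB. intros z hz. apply in_sep in hz. apply hAa, hz. }
      assert (hxb : rk (proj1_sig x) ∈ proj1_sig b).
      { rewrite rk_ord by eauto using ord_mem. exact (ord_trans ob hab hxa'). }
      destruct (val_onto il (x := proj1_sig x)) as (x' & ex); auto.
      destruct (val_onto il (x := proj1_sig B)) as (B' & eB); auto.
      exists x', B'. rewrite val_mem, hembL, ex, eB.
      split; auto. split; auto.
      apply model_V_sat2; auto; rewrite ?ex, ?eB; auto.
      now apply hsatK.
  - assert (hBl : proj1_sig B ⊆ l).
    { rewrite <- hxl. now apply (emb_subset (@val_mem k) (val_trans ik)). }
    destruct (refl_indesc hl (p := p) hBl) as (x & hx & _ & hxs).
    { split; auto. apply hsatK in hBs. now rewrite hxl in hBs. }
    destruct (val_onto ik (x := x)) as (x' & ex).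
    { apply rk_l_k. rewrite rk_ord; eauto using ord_mem. }
    destruct (val_onto ik (x := sep (fun z => z ∈ x) (proj1_sig B))) as (B' & eB).
    { apply rk_subset_in with (proj1_sig B); auto using val_rk.
      intros z hz. now apply in_sep in hz. }
    apply (hBn x' B').
    + now rewrite ex, hxl.
    + apply hemb. now rewrite ex.
    + apply hsatK. now rewrite ex, eB.
Qed.

Lemma model_axioms : reflective_axioms R.
Proof.
  split.
  - intros x. apply (model_comprehension (fun z => z ∈ reflective_set)).
  - intros a ha. apply restrict_iff in ha as [ha _].
    apply (emb_ordinal (@val_inj l) (@val_mem l) (val_trans il)).
    now apply model_ord.
  - exact model_indiscernible.
  - exact model_unbounded.
  - intros p e F x. apply model_replacement.
  - exact model_reflection.
  - intros a ha. apply restrict_iff in ha as [ha ha']. now apply reflective_regular.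
  - exact model_indescribable.
Qed.

End Model.

End SetTheory.

Theorem theorem3 (V : setStruct) (hV : ZFC V) (k : V) (hk : is_subtle k) :
  exists l vl vk r : V,
    is_regular l /\ is_V l vl /\ is_V k vk /\
    elementary_substructure vl vk /\
    r ⊆ l /\
    reflective_axioms (@restrict_pred V vl r).
Proof.
  assert (ik := subtle_inaccessible hV hk).
  assert (ok := inac_ord ik).
  destruct (reflecting_exists hV hk) as (l & hl).
  assert (il := refl_inac hl). assert (ol := inac_ord il).
  exists l, (Vf hV l), (Vf hV k), (reflective_set hV k l).
  split; [eapply regular_is_regular; [apply (inac_limit il) | apply (refl_reg hl)] |].
  split; [now apply is_V_Vf |]. split; [now apply is_V_Vf |]. split; [split |].
  - apply Vf_mono; auto. intros z hz. exact (ord_trans ok (refl_mem hl) hz).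
  - intros p _. apply (refl_elem hl).
  - split; [| exact (model_axioms ik hl)].
    intros z hz. now apply in_sep in hz.
Qed.
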